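(* Let $\lambda$ be a shape with set of interior vertices $V^o$. For a face $F$ of the reduced nonkissing complex $\widetilde\Delta^{NK}(\lambda)$ let $C(F)\subseteq\mathbb{R}^{V^o}$ be the cone generated by $\{g_p:\ p\in F\}$. Then the set $\mathcal{F}_\lambda=\{C(F):\ F\in\widetilde\Delta^{NK}(\lambda)\}$ is a complete simplicial fan in $\mathbb{R}^{V^o}$.
   Context: A shape is a finite vertex-induced subgraph $\lambda$ of the square grid $\mathbb{Z}^2$ (two points are adjacent iff they differ by 1 in exactly one coordinate and agree in the other). $(a,b)$ is immediately South of $(a,b+1)$ and immediately East of $(a-1,b)$; North and West are the reverse relations. A vertex of $\lambda$ is interior if all four of its grid neighbors are in $\lambda$, and a boundary vertex otherwise; $V^o$ is the set of interior vertices. A (boundary) path is a sequence of vertices $(v_0,\ldots,v_l)$ of $\lambda$, $l>0$, with $v_0,v_l$ boundary vertices, $v_1,\dots,v_{l-1}$ interior vertices, and each $v_i$ immediately South or East of $v_{i-1}$. A segment is a sequence of interior vertices $(v_0,\ldots,v_l)$, $l\ge 0$, with each $v_i$ immediately South or East of $v_{i-1}$. If $t=(v_i,\dots,v_j)$ is a segment contained in a path $p=(v_0,\dots,v_l)$, then $p$ enters $t$ from the West (resp. North) if $v_{i-1}$ is immediately West (resp. North) of $v_i$, and leaves $t$ to the East (resp. South) if $v_{j+1}$ is immediately East (resp. South) of $v_j$. The same language is used for a single interior vertex $t=(v)$. Two paths $p,q$ kiss along a common segment $s$ if (up to exchanging $p$ and $q$) $p$ enters $s$ from the West and leaves $s$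 to the South, while $q$ enters $s$ from the North and leaves $s$ to the East. They are nonkissing if they kiss along no segment. The reduced nonkissing complex $\widetilde\Delta^{NK}(\lambda)$ is the simplicial complex whose faces are the sets (including $\emptyset$) of pairwise nonkissing paths, none of which is horizontal (only East steps) or vertical (only South steps). For a path $p$, $g_p\in\mathbb{R}^{V^o}$ is the vector with $g_p(v)=1$ if $p$ enters $v$ from the North and leaves to the East, $g_p(v)=-1$ if $p$ enters $v$ from the West and leaves to the South, and $g_p(v)=0$ otherwise. A fan is a finite set of polyhedral cones closed under taking faces such that the intersection of any two of its cones is again a cone of the set (and a face of each). It is complete if the union of its cones is the whole space, and simplicial if each cone is pointed with linearly independent extreme rays. *)

(* Defs.v *)
From HB Require Import structures.
From mathcomp Require Import all_boot all_order all_algebra finmap.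
From mathcomp Require Import boolp classical_sets cardinality reals.

Set Implicit Arguments.
Unset Strict Implicit.
Unset Printing Implicit Defensive.

Import Order.TTheory GRing.Theory Num.Theory.

Local Open Scope ring_scope.
Local Open Scope classical_set_scope.

Definition vertex := (int * int)%type.

Definition west (v : vertex) : vertex := (v.1 - 1, v.2).
Definition east (v : vertex) : vertex := (v.1 + 1, v.2).
Definition south (v : vertex) : vertex := (v.1, v.2 - 1).
Definition north (v : vertex) : vertex := (v.1, v.2 + 1).

(* A vertex-induced subgraph is determined by its set of vertices. *)
Definition grid_shape := {fset vertex}.

Definition interior (lam : grid_shape) : {fset vertex} :=
  [fset v in lam | [&& west v \in lam, east v \in lam,
                       south v \in lam & north v \in lam]]%fset.

Definition boundary (lam : grid_shape) : {fset vertex} := (lam `\` interior lam)%fset.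

Definition se_step : rel vertex := [rel u v | (v == south u) || (v == east u)].

Definition boundary_path (lam : grid_shape) (p : seq vertex) : bool :=
  if p is u :: w :: s then
    [&& u \in boundary lam, all (mem (interior lam)) (belast w s),
        last w s \in boundary lam & path se_step u (w :: s)]
  else false.

Definition segment (lam : grid_shape) (s : seq vertex) : bool :=
  [&& s != [::], all (mem (interior lam)) s & sorted se_step s].

(* [dir v] is the neighbour of [v] in the given direction, so that
   [enters west p t] reads "p contains t and enters it from the West". *)
Definition enters (dir : vertex -> vertex) (p t : seq vertex) : bool :=
  if t is v :: _ then infix (dir v :: t) p else false.

Definition leaves (dir : vertex -> vertex) (p t : seq vertex) : bool :=
  if t is v :: t' then infix (rcons t (dir (last v t'))) p else false.

Definition kiss_along (p q s : seq vertex) : bool :=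
  [&& enters west p s, leaves south p s, enters north q s & leaves east q s]
  || [&& enters west q s, leaves south q s, enters north p s & leaves east p s].

Definition kissing (lam : grid_shape) (p q : seq vertex) : Prop :=
  exists2 s, segment lam s & kiss_along p q s.

Definition horizontal (p : seq vertex) : bool :=
  sorted [rel u v | v == east u] p.

Definition vertical (p : seq vertex) : bool :=
  sorted [rel u v | v == south u] p.

(* The faces of the reduced nonkissing complex. *)
Definition reduced_NK (lam : grid_shape) : set {fset seq vertex} :=
  [set F | (forall p, p \in F ->
              [/\ boundary_path lam p, ~~ horizontal p & ~~ vertical p]) /\
           (forall p q, p \in F -> q \in F -> p != q -> ~ kissing lam p q)].

Section Cones.
Variables (R : realType) (E : vectType R).
Implicit Types (C D : set E) (S : set (set E)).

Definition cone (X : {fset E}) : set E :=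
  [set x | exists2 c : E -> R, (forall v, 0 <= c v)
                             & x = \sum_(v <- X) c v *: v].

Definition polyhedral_cone C : Prop := exists X : {fset E}, C = cone X.

(* [face_of D C]: D is the face of C cut out by a supporting hyperplane, or C
   itself (f = 0). *)
Definition face_of D C : Prop :=
  exists f : {linear E -> R^o},
    (forall x, C x -> 0 <= f x) /\ D = [set x | C x /\ f x = 0].

Definition pointed C : Prop := forall x, C x -> C (- x) -> x = 0.

Definition extreme_ray D C : Prop :=
  face_of D C /\ exists2 v : E, v != 0 & D = cone [fset v]%fset.

Definition simplicial_cone C : Prop :=
  pointed C /\
  exists2 X : seq E, free X
    & [set D | extreme_ray D C] = [set cone [fset v]%fset | v in [set` X]].

Record fan S : Prop := Fan {
  fan_finite : finite_set S;
  fan_polyhedral : forall C, S C -> polyhedral_cone C;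
  fan_face : forall C D, S C -> face_of D C -> S D;
  fan_cap : forall C D, S C -> S D ->
    [/\ S (C `&` D), face_of (C `&` D) C & face_of (C `&` D) D] }.

Definition complete_fan S : Prop := \bigcup_(C in S) C = setT.

Definition simplicial_fan S : Prop := forall C, S C -> simplicial_cone C.

End Cones.

Section NonkissingFan.
Variables (R : realType) (lam : grid_shape).

Definition gspace := {ffun interior lam -> R^o}.

Definition gvec (p : seq vertex) : gspace :=
  [ffun v : interior lam =>
     if enters north p [:: val v] && leaves east p [:: val v] then 1
     else if enters west p [:: val v] && leaves south p [:: val v] then -1
     else 0].

Definition NK_cone (F : {fset seq vertex}) : set gspace :=
  cone [fset gvec p | p in F]%fset.

Definition NK_fan : set (set gspace) := [set NK_cone F | F in reduced_NK lam].

End NonkissingFan.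

Arguments NK_cone R lam F : clear implicits.
Arguments NK_fan R lam : clear implicits.

(* Main.v *)
(* For a flow on the grid (nonnegative edge weights, conserved at the interior
   vertices), g-vectors only see the flow: the combination of the g-vectors of
   weighted paths has coordinate flow(v -> east v) - flow(west v -> v) at v.
   Think of the edge u -> v as the interval [0, f u v], and glue the intervals
   at an interior vertex: the West edge comes before the North edge, and the
   East edge before the South edge.  A point of an edge then follows a unique
   boundary path; the lengths of the sets of points following the same path
   decompose the flow, and two paths that get positive length do not kiss,
   because a kiss would reverse the order of the points.  Conversely, in a
   family of pairwise nonkissing paths the paths through a vertex are ordered in
   the same way by their pasts and by their futures, so the weight of each path
   is the length computed from the flow.  Given a vector x, a flow with
   coordinates x is unique up to adding straight paths, which have zero g-vector
   and kiss no path: hence x is in exactly one way a positive combination of the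
   g-vectors of a face. *)

Require Import Defs.
From HB Require Import structures.
From mathcomp Require Import all_boot all_order all_algebra finmap.
From mathcomp Require Import boolp classical_sets cardinality reals.
From mathcomp Require Import zify lra.

Set Implicit Arguments.
Unset Strict Implicit.
Unset Printing Implicit Defensive.

Import Order.TTheory GRing.Theory Num.Theory.

Local Open Scope ring_scope.

(** * Grid steps and the edges of South-East sequences *)

Section Steps.

Definition edge (u v : vertex) (p : seq vertex) : bool := infix [:: u; v] p.

(** Every South or East step raises [rank] by one, so it serves as the measure for inductions along
    paths. *)
Definition rank (v : vertex) : int := v.1 - v.2.

Lemma se_step_rank u v : se_step u v -> rank v = rank u + 1.
Proof. by rewrite /rank; case/orP=> /eqP -> /=; lia. Qed.

Lemma north_south v : north (south v) = v.
Proof. by case: v => a b; rewrite /north /south /= subrK. Qed.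

Lemma west_east v : west (east v) = v.
Proof. by case: v => a b; rewrite /west /east /= addrK. Qed.

Lemma south_north v : south (north v) = v.
Proof. by case: v => a b; rewrite /north /south /= addrK. Qed.

Lemma east_west v : east (west v) = v.
Proof. by case: v => a b; rewrite /west /east /= subrK. Qed.

Lemma se_step_east u : se_step u (east u).
Proof. by rewrite /se_step /= eqxx orbT. Qed.

Lemma se_step_south u : se_step u (south u).
Proof. by rewrite /se_step /= eqxx. Qed.

Lemma se_step_west v : se_step (west v) v.
Proof. by rewrite -{2}(east_west v) se_step_east. Qed.

Lemma se_step_north v : se_step (north v) v.
Proof. by rewrite -{2}(south_north v) se_step_south. Qed.

Lemma south_eq_east v : (south v == east v) = false.
Proof. by case: v => a b; apply/negP => /eqP [] ? ?; lia. Qed.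

Lemma north_eq_west v : (north v == west v) = false.
Proof. by case: v => a b; apply/negP => /eqP [] ? ?; lia. Qed.

Lemma se_stepP u v : se_step u v -> u = west v \/ u = north v.
Proof.
by case/orP=> /eqP ->; [right; rewrite north_south | left; rewrite west_east].
Qed.

Lemma se_sorted_uniq p : sorted se_step p -> uniq p.
Proof.
move=> sp; apply: (@sorted_uniq _ [rel u v | rank u < rank v]).
- by move=> y x z /=; apply: lt_trans.
- by move=> x /=; rewrite ltxx.
- by apply: sub_sorted sp => u v /se_step_rank /= ->; rewrite ltrDl.
Qed.

(** Without repetitions, the index of [v] fixes where the list is cut. *)
Lemma cat_cons_inj (T : eqType) (v : T) a a' b b' :
  uniq (a ++ v :: b) -> a ++ v :: b = a' ++ v :: b' -> a = a' /\ b = b'.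
Proof.
move=> U E; have U' := U; rewrite E in U'.
have na : v \notin a.
  by move: U; rewrite cat_uniq /= negb_or -!andbA => /and5P[_ ->].
have na' : v \notin a'.
  by move: U'; rewrite cat_uniq /= negb_or -!andbA => /and5P[_ ->].
have sz : size a = size a'.
  have := congr1 (index v) E.
  by rewrite !index_cat (negbTE na) (negbTE na') /= eqxx !addn0.
by move/eqP: E; rewrite eqseq_cat // eqseq_cons eqxx /= => /andP[/eqP-> /eqP->].
Qed.

(** Both infixes contain the only occurrence of [v], so they overlap exactly there. *)
Lemma infix_glue (T : eqType) (p s t : seq T) (v : T) :
  uniq p -> infix (rcons s v) p -> infix (v :: t) p ->
  infix (rcons s v ++ t) p.
Proof.
move=> U /infixP[a [b Ep]] /infixP[a' [b' Ep']].
have Ep2 : p = (a ++ s) ++ v :: b by rewrite Ep -cats1 -!catA.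
have [_ Eb] : a ++ s = a' /\ b = t ++ b'.
  by apply: (@cat_cons_inj _ v); rewrite -Ep2 // Ep'.
by apply/infixP; exists a, b'; rewrite Ep Eb -!catA.
Qed.

Section Edges.
Variable p : seq vertex.
Hypothesis sp : sorted se_step p.

Lemma edge_se u v : edge u v p -> se_step u v.
Proof.
by move/infix_sorted => /(_ se_step sp); rewrite /= andbT.
Qed.

Lemma edge_out_inj u v v' : edge u v p -> edge u v' p -> v = v'.
Proof.
case/infixP=> a [b E] /infixP[a' [b' E']].
have U := se_sorted_uniq sp; rewrite E /= in U.
by have [|_ []//] := @cat_cons_inj _ u a a' (v :: b) (v' :: b') U; rewrite -E.
Qed.

Lemma edge_in_inj u u' v : edge u v p -> edge u' v p -> u = u'.
Proof.
case/infixP=> a [b E] /infixP[a' [b' E']].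
have U := se_sorted_uniq sp; rewrite E /= -cat_rcons in U.
have [|] := @cat_cons_inj _ v (rcons a u) (rcons a' u') b b' U.
  by rewrite !cat_rcons -E.
by move=> /eqP; rewrite eqseq_rcons => /andP[_ /eqP].
Qed.

Lemma edge_in_count u v : edge u v p ->
  (edge (west v) v p + edge (north v) v p)%N = 1%N.
Proof.
move=> uv; have H x : edge x v p = (x == u).
  by apply/idP/eqP => [xv|->//]; exact: edge_in_inj xv uv.
rewrite !H; have [->|->] := se_stepP (edge_se uv).
  by rewrite eqxx north_eq_west.
by rewrite eqxx eq_sym north_eq_west.
Qed.

Lemma edge_out_count u v : edge u v p ->
  (edge u (east u) p + edge u (south u) p)%N = 1%N.
Proof.
move=> uv; have H x : edge u x p = (x == v).
  by apply/idP/eqP => [ux|->//]; exact: edge_out_inj ux uv.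
rewrite !H; have /orP[/eqP ->|/eqP ->] := edge_se uv.
  by rewrite eqxx eq_sym south_eq_east.
by rewrite eqxx south_eq_east.
Qed.

End Edges.
End Steps.

(** * Boundary paths read from their end *)

Section Walks.
Variable lam : grid_shape.
Local Notation I := (interior lam).

(* Initial parts of boundary paths, listed from the end: the head is the
   current vertex and the last element is the starting point. *)
Fixpoint rwalk (r : seq vertex) : bool :=
  if r is v :: r' then
    if r' is u :: r'' then
      se_step u v && (if r'' is _ :: _ then (u \in I) && rwalk r'
                      else u \notin I)
    else false
  else false.

Lemma rwalk_rev u w s : rwalk (rev (u :: w :: s)) =
  [&& u \notin I, all (mem I) (belast w s) & path se_step u (w :: s)].
Proof.
elim/last_ind: s => [|s z IH]; first by rewrite /= !andbT andbC.
rewrite -!rcons_cons rev_rcons.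
have E : rev (u :: w :: s) = last w s :: rev (u :: belast w s).
  by rewrite lastI rev_rcons.
move: IH; rewrite E.
have [x [y Ey]] : exists x y, rev (u :: belast w s) = x :: y.
  case Er: (rev _) => [|x y]; last by exists x, y.
  by have := congr1 size Er; rewrite size_rev.
rewrite Ey -/(rwalk _) => IH.
transitivity [&& se_step (last w s) z, last w s \in I & rwalk (last w s :: x :: y)] => //.
rewrite IH belast_rcons /= rcons_path.
have -> : (w \in I) && all (mem I) s = all (mem I) (w :: s) by [].
rewrite lastI all_rcons /=.
case: (u \in I) => /=; first by rewrite !andbF.
case: (last w s \in I) => /=; last by rewrite !andbF.
case: (all _ _) => /=; last by rewrite !andbF.
by rewrite andbC -andbA.
Qed.

(* The size condition discards the paths without interior vertices. *)
Definition bpath (p : seq vertex) : bool := boundary_path lam p && (2 < size p)%N.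

Lemma interior_lam v : v \in I -> [/\ v \in lam, west v \in lam, east v \in lam,
  south v \in lam & north v \in lam].
Proof. by rewrite !inE /= => /and5P[]. Qed.

(** From right to left, the two ends lie in [lam] because they are neighbours of interior vertices,
    which exist as the path has more than two vertices. *)
Lemma bpathP p : bpath p <->
  [/\ rwalk (rev p), head (0, 0) (rev p) \notin I & (2 < size p)%N].
Proof.
rewrite /bpath; case: p => [|u [|w s]] /=; [by split=> [|[]] | by split=> [|[]] |].
have -> : head (0, 0) (rev [:: u, w & s]) = last w s by rewrite lastI rev_rcons.
rewrite rwalk_rev /=.
split.
  case/andP=> /and4P[]; rewrite !in_fsetD => /andP[uI _] al /andP[lI _] /andP[-> ->].
  by rewrite uI al lI.
case=> /and3P[uI al /andP[st pa]] lI sz; rewrite sz al st pa !in_fsetD uI lI /= !andbT.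
case: s sz al pa {lI} => // z s _ /= /andP[wI al] /andP[sz pa].
have [wl ww we ws wn] := interior_lam wI.
apply/andP; split; first by case: (se_stepP st) => ->.
elim: s w z {st ww wn wl} wI we ws al sz pa => [|y s IH] w z wI we ws /= al.
  by case/orP => /eqP ->.
case/andP: al => zI al _ /andP[st' pa].
have [zl zw ze zs zn] := interior_lam zI.
by apply: (IH z y).
Qed.

Lemma rwalk_cat b v u a : rwalk (b ++ v :: u :: a) ->
  [/\ se_step u v, (u \in I) = (a != [::]), b != [::] -> v \in I
     & rwalk (v :: u :: a)].
Proof.
elim: b => [|w b IH] H.
  have /andP[st] : rwalk (v :: u :: a) by [].
  by case: a H => [|x a] H ua; split=> //; [apply/negbTE | case/andP: ua => ->].
have {}H : rwalk (w :: (b ++ v :: u :: a)) by [].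
have [bI wb] : (head v b \in I) /\ rwalk (b ++ v :: u :: a).
  by move: H; case: (b) => [|x [|y c]] /= /andP[_ /andP[-> ->]].
have [st uI bv wv] := IH wb; split=> // _.
by case: (b) bI bv => // ? ? _; apply.
Qed.

Section BPath.
Variable p : seq vertex.
Hypothesis bp : bpath p.

Lemma bpath_sorted : sorted se_step p.
Proof.
move: bp; case/andP; case: (p) => [|u [|w s]] //.
by case/and4P.
Qed.

Lemma bpath_edge u v : edge u v p -> exists a b,
  [/\ p = a ++ u :: v :: b, (u \in I) = (a != [::]) & (v \in I) = (b != [::])].
Proof.
case/infixP=> a [b E]; exists a, b; have [W H _] := (bpathP p).1 bp.
move: W H; have -> : rev p = rev b ++ [:: v, u & rev a].
  by rewrite E !rev_cat -catA.
case/rwalk_cat => _ uI bv _ hI; split=> //.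
  by rewrite uI -size_eq0 size_rev size_eq0.
move: bv hI; rewrite -size_eq0 size_rev size_eq0; case: b {E} => /= [_ /negbTE -> //|x b].
by move=> ->.
Qed.

Lemma bpath_pred u v : edge u v p -> u \in I -> exists x, edge x u p.
Proof.
case/bpath_edge=> a [b [E -> _]]; case/lastP: a E => // a x E _.
by exists x; apply/infixP; exists a, (v :: b); rewrite E -cats1 -catA.
Qed.

Lemma bpath_succ u v : edge u v p -> v \in I -> exists x, edge v x p.
Proof.
case/bpath_edge=> a [b [E _ ->]]; case: b E => // x b E _.
by exists x; apply/infixP; exists (rcons a u), b; rewrite E -cats1 -catA.
Qed.

Lemma bpath_in u v : edge u v p -> u \in I ->
  (edge (west u) u p + edge (north u) u p)%N = 1%N.
Proof. by move=> uv uI; have [x /(edge_in_count bpath_sorted)] := bpath_pred uv uI. Qed.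

Lemma bpath_out u v : edge u v p -> v \in I ->
  (edge v (east v) p + edge v (south v) p)%N = 1%N.
Proof. by move=> uv uI; have [x /(edge_out_count bpath_sorted)] := bpath_succ uv uI. Qed.

(** Conservation at interior vertices for a single path. *)
Lemma bpath_through v : v \in I ->
  (edge (west v) v p + edge (north v) v p
   = edge v (east v) p + edge v (south v) p)%N.
Proof.
move=> vI.
have [H|/norP[nW nN]] := boolP (edge (west v) v p || edge (north v) v p).
  have [u uv] : exists u, edge u v p by case/orP: H; [exists (west v)|exists (north v)].
  by rewrite (bpath_out uv vI) (edge_in_count bpath_sorted uv).
have [H|/norP[nE nS]] := boolP (edge v (east v) p || edge v (south v) p).
  have [w vw] : exists w, edge v w p by case/orP: H; [exists (east v)|exists (south v)].
  by rewrite (bpath_in vw vI) (edge_out_count bpath_sorted vw).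
by rewrite (negbTE nW) (negbTE nN) (negbTE nE) (negbTE nS).
Qed.

End BPath.

End Walks.

(** * Positions on the edges of a flow, and the weights of paths *)

Section Positions.
Variables (R : realType) (lam : grid_shape) (f : vertex -> vertex -> R).
Local Notation I := (interior lam).
Local Notation rwalk := (rwalk lam).

(** [pos_in] maps a point of an incoming edge to the glued interval at [v]; [pos_out] maps a point
    of that interval to an outgoing edge. *)
Definition pos_in (u v : vertex) (y : R) : R :=
  if u == west v then y else f (west v) v + y.

Definition pos_out (v w : vertex) (y : R) : R :=
  if w == east v then Num.min y (f v (east v))
  else y - Num.min y (f v (east v)).

(* [pos b r] is the position, on the last edge of the walk [r], of the left
   ([b = false]) or right end of the first edge; clamping in [pos_out] keeps the
   part of the first edge that does not follow [r] from contributing a length. *)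
Fixpoint pos (b : bool) (r : seq vertex) : R :=
  if r is w :: r' then
    if r' is v :: r'' then
      if r'' is u :: _ then pos_out v w (pos_in u v (pos b r')) else f v w *+ b
    else 0
  else 0.

Definition wgt (p : seq vertex) : R := pos true (rev p) - pos false (rev p).

Lemma pos_in_homo u v y z : y <= z -> pos_in u v y <= pos_in u v z.
Proof. by rewrite /pos_in; case: ifP => _ //; lra. Qed.

Lemma pos_out_homo v w y z : y <= z -> pos_out v w y <= pos_out v w z.
Proof. by rewrite /pos_out /Num.min; case: ifP => _; do 2!case: ltP => ?; lra. Qed.

(** The South edge collapses everything up to the cut [f v (east v)] to a point, so a positive
    length there must reach beyond the cut. *)
Lemma pos_out_south_lt v y z : pos_out v (south v) y < pos_out v (south v) z ->
  f v (east v) < z.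
Proof.
rewrite /pos_out south_eq_east; case: (leP z (f v (east v))) => // zf.
by rewrite subrr subr_lt0 lt_min ltxx.
Qed.

Lemma pos_out_east_lt v y z : pos_out v (east v) y < pos_out v (east v) z ->
  y < f v (east v).
Proof.
rewrite /pos_out eqxx; case: (leP (f v (east v)) y) => // fy.
by rewrite lt_min ltxx andbF.
Qed.

Hypothesis f_ge0 : forall u v, 0 <= f u v.
Hypothesis f_cons : forall v : vertex, v \in I ->
  f (west v) v + f (north v) v = f v (east v) + f v (south v).

Lemma pos_in_bounds u v y : se_step u v -> 0 <= y <= f u v ->
  0 <= pos_in u v y <= f (west v) v + f (north v) v.
Proof.
move=> /se_stepP uv /andP[y0 yf]; rewrite /pos_in.
have := f_ge0 (west v) v; have := f_ge0 (north v) v.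
case: uv yf => ->; first by rewrite eqxx; lra.
by rewrite north_eq_west; lra.
Qed.

Lemma pos_out_bounds v w y : v \in I -> se_step v w ->
  0 <= y <= f (west v) v + f (north v) v -> 0 <= pos_out v w y <= f v w.
Proof.
move=> /f_cons -> vw /andP[y0 yf]; rewrite /pos_out.
have := f_ge0 v (east v); have := f_ge0 v (south v).
case/orP: vw yf => /eqP ->; last by rewrite eqxx /Num.min; case: ltP => ?; lra.
by rewrite south_eq_east /Num.min; case: ltP => ?; lra.
Qed.

Lemma pos_homo r : pos false r <= pos true r.
Proof.
elim: r => [|w [|v [|u r]] IH] //; first exact: f_ge0.
by apply: pos_out_homo; apply: pos_in_homo.
Qed.

Lemma pos_bounds b w v r : rwalk [:: w, v & r] -> 0 <= pos b [:: w, v & r] <= f v w.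
Proof.
elim: r w v => [|u r IH] w v.
  by move=> _ /=; have := f_ge0 v w; case: b => /=; lra.
move=> H; have [vw [vI W]] : se_step v w /\ v \in I /\ rwalk [:: v, u & r].
  by move: H => /andP[-> /andP[-> ]].
apply: pos_out_bounds => //; apply: pos_in_bounds; last exact: IH.
by case/andP: W.
Qed.

(** Once the interval of a walk has shrunk to a point, it stays a point along every continuation. *)
Lemma pos_eq_cat s r : pos true r = pos false r -> (1 < size r)%N ->
  pos true (s ++ r) = pos false (s ++ r).
Proof.
move=> E sz; elim: s => // w s.
rewrite cat_cons; case Es: (s ++ r) => [|v [|u t]] IH //=.
  by have := congr1 size Es; rewrite size_cat; move: sz => /= ? ?; lia.
by rewrite -/(pos _ [:: v, u & t]) IH.
Qed.

Lemma wgt_ge0 p : 0 <= wgt p.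
Proof. by rewrite subr_ge0 pos_homo. Qed.

Lemma wgt_gt0 p s r : 0 < wgt p -> rev p = s ++ r -> (1 < size r)%N ->
  pos false r < pos true r.
Proof.
move=> w0 E sz; rewrite lt_neqAle pos_homo andbT; apply/eqP => H.
by move: w0; rewrite /wgt E pos_eq_cat ?subrr ?ltxx.
Qed.

(** An end of the interval of [t], as a coordinate on the glued interval at the head of [t]; entry
    [1] of [t] is the vertex before the head. *)
Definition vertex_pos b (t : seq vertex) : R :=
  pos_in (nth (0, 0) t 1) (head (0, 0) t) (pos b t).

Lemma vertex_pos_cons b w r v x a :
  vertex_pos b (w :: r ++ [:: v, x & a]) = pos_in (head v r) w
    (pos_out (head v r) w (vertex_pos b (r ++ [:: v, x & a]))).
Proof. by case: r => [|u [|u' r]]. Qed.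

(* A path entering a common segment from the West has lower positions than one
   entering it from the North, and the order persists along the segment. *)
Lemma vertex_pos_segment r v a b : rwalk [:: v, west v & a] ->
  rwalk [:: v, north v & b] ->
  vertex_pos true (r ++ [:: v, west v & a])
  <= vertex_pos false (r ++ [:: v, north v & b]).
Proof.
move=> Wa Wb; elim: r => [|w r IH].
  have /andP[_ wa] := pos_bounds true Wa; have /andP[nb _] := pos_bounds false Wb.
  by rewrite /vertex_pos /pos_in eqxx north_eq_west; lra.
rewrite !cat_cons !vertex_pos_cons.
by apply: pos_in_homo; apply: pos_out_homo.
Qed.

Lemma pos_consE b w v u r :
  pos b [:: w, v, u & r] = pos_out v w (vertex_pos b [:: v, u & r]).
Proof. by []. Qed.

Lemma infix_last (T : eqType) (v x : T) s p :
  infix (v :: rcons s x) p -> infix [:: last v s; x] p.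
Proof.
have -> : v :: rcons s x = belast v s ++ [:: last v s; x].
  by rewrite -rcons_cons lastI -!cats1 -catA.
by case/infixP=> a [b ->]; apply/infixP; exists (a ++ belast v s), b; rewrite -!catA.
Qed.

Lemma wgt_nonkissing p q : bpath lam p -> bpath lam q ->
  0 < wgt p -> 0 < wgt q -> ~ kissing lam p q.
Proof.
move=> bp bq wp wq [s /and3P[s0 sI ss] /orP K].
suff main p' q' : bpath lam p' -> bpath lam q' -> 0 < wgt p' -> 0 < wgt q' ->
    [&& enters west p' s, leaves south p' s, enters north q' s & leaves east q' s] ->
    False by case: K; apply: main.
move: p' q' => {wp wq bp bq K}p {}q bp bq wp wq /and4P[].
case: s s0 sI ss => // v s _ sI ss /=.
move=> iw ls inn le.
have up : uniq p by apply/se_sorted_uniq/(bpath_sorted bp).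
have uq : uniq q by apply/se_sorted_uniq/(bpath_sorted bq).
have Gp : infix (west v :: rcons (v :: s) (south (last v s))) p.
  rewrite -cats1 -cat_cons; have -> : west v :: v :: s = rcons (west v :: belast v s) (last v s).
    by rewrite rcons_cons -lastI.
  apply: infix_glue => //; first by rewrite rcons_cons -lastI.
  exact: infix_last.
have Gq : infix (north v :: rcons (v :: s) (east (last v s))) q.
  rewrite -cats1 -cat_cons; have -> : north v :: v :: s = rcons (north v :: belast v s) (last v s).
    by rewrite rcons_cons -lastI.
  apply: infix_glue => //; first by rewrite rcons_cons -lastI.
  exact: infix_last.
have {Gp iw ls} [a [b Ep]] := infixP Gp; have {Gq inn le} [a' [b' Eq]] := infixP Gq.
set l := last v s in Ep Eq.
have Erp : rev p = rev b ++ [:: south l] ++ rev s ++ [:: v, west v & rev a].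
  by rewrite Ep !rev_cat !(rev_cons, rev_rcons) -!cats1 -!catA /= -!catA.
have Erq : rev q = rev b' ++ [:: east l] ++ rev s ++ [:: v, north v & rev a'].
  by rewrite Eq !rev_cat !(rev_cons, rev_rcons) -!cats1 -!catA /= -!catA.
have [Wp _ _] := (bpathP lam p).1 bp; have [Wq _ _] := (bpathP lam q).1 bq.
have Wa : rwalk [:: v, west v & rev a].
  by move: Wp; rewrite Erp !catA => /rwalk_cat[].
have Wb : rwalk [:: v, north v & rev a'].
  by move: Wq; rewrite Erq !catA => /rwalk_cat[].
have := vertex_pos_segment (rev s) Wa Wb.
(* Exposes [l] and its predecessor with the entry point as a parameter, so that one equation serves
   both paths. *)
have [c [d Ec]] : exists c d, forall x y, rev s ++ [:: v, x & y] = [:: l, c x & d x y].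
  rewrite /l; case/lastP: (s) => [|s' z]; first by exists id, (fun _ y => y).
  rewrite last_rcons rev_rcons /=.
  case Es: (rev s') => [|z' s'']; first by exists (fun=> v), (fun x y => [:: x & y]).
  by exists (fun=> z'), (fun x y => s'' ++ [:: v, x & y]).
rewrite !Ec in Erp Erq *.
(* Leaving South puts the right end of [p] beyond the cut at [l], and leaving East puts the left end
   of [q] before it, against the order obtained at [l]. *)
have /pos_out_south_lt := wgt_gt0 wp Erp erefl.
have /pos_out_east_lt := wgt_gt0 wq Erq erefl.
by move=> qf fp pq; have := lt_le_trans (lt_trans qf fp) pq; rewrite ltxx.
Qed.


(** A path visits [u] once, so its edge out of [u] is the one that follows the prefix. *)
Lemma prefix_edge p s u v : bpath lam p ->
  prefix (rcons (rcons s u) v) p = prefix (rcons s u) p && edge u v p.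
Proof.
move=> bp; have up : uniq p by apply/se_sorted_uniq/(bpath_sorted bp).
apply/idP/andP.
  case/prefixP=> b ->; split; first by rewrite -[rcons _ v]cats1 -catA prefix_prefix.
  by apply/infixP; exists s, b; rewrite -!cats1 -!catA.
case=> /prefixP[b Eb] /infixP[a [b' E]].
have [] : s = a /\ b = v :: b'.
  by apply: (@cat_cons_inj _ u); rewrite -cat_rcons -Eb // E.
by move=> _ Ev; rewrite Eb Ev -[v :: b']cat1s catA cats1 prefix_prefix.
Qed.

Lemma rev_cons2 (T : Type) (w v : T) r : rev [:: w, v & r] = rcons (rcons (rev r) v) w.
Proof. by rewrite !rev_cons. Qed.

Lemma prefix_edge_last p w v r : prefix (rev [:: w, v & r]) p -> edge v w p.
Proof.
rewrite rev_cons2 => /prefixP[b ->].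
by apply/infixP; exists (rev r), b; rewrite -!cats1 -!catA.
Qed.

Lemma prefix_split p w v r : bpath lam p -> w \in I ->
  nat_of_bool (prefix (rev [:: w, v & r]) p)
  = (prefix (rev [:: east w, w, v & r]) p + prefix (rev [:: south w, w, v & r]) p)%N.
Proof.
move=> bp wI.
rewrite ![rev [:: _, w, v & r]]rev_cons2 !prefix_edge // -rev_cons.
have [/prefix_edge_last vw|] //= := boolP (prefix _ p).
by rewrite (bpath_out bp vw wI).
Qed.

(** * The path weights decompose the flow *)

Section Paths.
Variable P : seq (seq vertex).
Hypothesis P_uniq : uniq P.
Hypothesis mem_P : forall p : seq vertex, (p \in P) = bpath lam p.
Variables lo hi : int.
Hypothesis rank_lo : forall v : vertex, v \in I -> lo <= rank v.
Hypothesis rank_hi : forall v : vertex, v \in I -> rank v <= hi.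

(** As [w] is not interior, the prefix is a complete path and no other path extends it: the sum has
    one term. *)
Lemma sum_wgt_end w v r : rwalk [:: w, v & r] -> v \in I -> w \notin I ->
  \sum_(p <- P) wgt p *+ prefix (rev [:: w, v & r]) p
  = pos true [:: w, v & r] - pos false [:: w, v & r].
Proof.
move=> W vI wI.
have bt : bpath lam (rev [:: w, v & r]).
apply/bpathP; rewrite revK size_rev; split=> //=.
  by move: W; case: (r) => //= /andP[_]; rewrite vI.
rewrite (bigD1_seq (rev [:: w, v & r])) ?mem_P //= prefix_refl mulr1n.
rewrite {1}/wgt revK big1_seq ?addr0 // => p /andP[np]; rewrite mem_P => bp.
have [pre|] := boolP (prefix _ p); last by rewrite mulr0n.
have [a [b [E _ wb]]] := bpath_edge bp (prefix_edge_last pre).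
have up : uniq p by apply/se_sorted_uniq/(bpath_sorted bp).
case: b E wb => [|x b] E; last by rewrite (negbTE wI).
move: pre np; rewrite rev_cons2 => /prefixP[b' E'].
rewrite {}E' -[in rcons _ w]cats1 -catA /= in up E *.
have [|_ <-] := @cat_cons_inj _ w _ (rcons a v) _ [::] up; first by rewrite E cat_rcons.
by rewrite eqxx.
Qed.

(** Induction towards the end of the paths: at an interior [w] the interval is cut into an East and
    a South part whose lengths add up. [n] bounds the number of steps still possible. *)
Lemma sum_wgt_prefix n w v r : hi < rank w + n%:Z -> rwalk [:: w, v & r] ->
  (v \in I) || (w \in I) ->
  \sum_(p <- P) wgt p *+ prefix (rev [:: w, v & r]) p
  = pos true [:: w, v & r] - pos false [:: w, v & r].
Proof.
elim: n w v r => [|n IH] w v r hn W; have [wI|wI] := boolP (w \in I);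
  rewrite ?orbT ?orbF => inI; try by apply: sum_wgt_end.
  by have := rank_hi wI; move: hn; lia.
  have st x : se_step w x -> rwalk [:: x, w, v & r].
    by move=> wx; rewrite /= wx wI; exact: W.
  have fuel x : se_step w x -> hi < rank x + n%:Z.
    by move=> /se_step_rank ->; move: hn; lia.
  have HE := IH _ _ _ (fuel _ (se_step_east w)) (st _ (se_step_east w)).
  have HS := IH _ _ _ (fuel _ (se_step_south w)) (st _ (se_step_south w)).
  rewrite !wI in HE HS; have {}HE := HE isT; have {}HS := HS isT.
  transitivity (\sum_(p <- P) wgt p *+ prefix (rev [:: east w, w, v & r]) p
     + \sum_(p <- P) wgt p *+ prefix (rev [:: south w, w, v & r]) p).
    rewrite -big_split; apply: eq_big_seq => p; rewrite mem_P => bp.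
    by rewrite (prefix_split v r bp wI) mulrnDr.
  rewrite HE HS !(@pos_consE _ _ w) /vertex_pos /pos_out eqxx south_eq_east.
  by rewrite /pos_in; case: ifP => _; lra.
Qed.

(** The walks from a non-interior vertex whose last edge is [u -> v], listed from the end. The bound
    [n] suffices once [rank u < lo + n%:Z], since [u] is then outside the interior when [n] is
    [0]. *)
Fixpoint back_walks (n : nat) (u v : vertex) : seq (seq vertex) :=
  if n is n'.+1 then
    if u \in I then
      map (cons v) (back_walks n' (west u) u ++ back_walks n' (north u) u)
    else [:: [:: v; u]]
  else [:: [:: v; u]].

Lemma back_walks_shape n u v r : r \in back_walks n u v ->
  exists s, r = [:: v, u & s].
Proof.
elim: n u v r => [|n IH] u v r /=; first by rewrite inE => /eqP ->; exists [::].
case: ifP => _; last by rewrite inE => /eqP ->; exists [::].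
case/mapP => r' + ->; rewrite mem_cat.
by case/orP => /IH [s ->]; eexists.
Qed.

Lemma back_walks_rwalk n u v r : rank u < lo + n%:Z -> se_step u v ->
  r \in back_walks n u v -> rwalk r.
Proof.
have start x y t : x \notin I -> se_step x y -> t \in [:: [:: y; x]] -> rwalk t.
  by move=> xI xy; rewrite inE => /eqP -> /=; rewrite xy xI.
elim: n u v r => [|n IH] u v r un uv.
  by apply: start => //; apply/negP => /rank_lo; move: un; lia.
rewrite /=; case: ifP => uI; last by apply: start => //; rewrite uI.
case/mapP => r' + ->; rewrite mem_cat => r'B.
have ru x : se_step x u -> rank x < lo + n%:Z.
  by move=> xu; move: un; rewrite (se_step_rank xu); lia.
have st : rwalk r'.
  case/orP: r'B; apply: IH; rewrite ?se_step_west ?se_step_north //.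
    exact: ru (se_step_west u).
  exact: ru (se_step_north u).
have [x [s E]] : exists x s, r' = [:: u, x & s].
  by case/orP: r'B => /back_walks_shape [s ->]; eexists; exists s.
by rewrite E in st *; rewrite /= uv uI; exact: st.
Qed.

(** Going back from [u], a path has one predecessor at each interior vertex, so exactly one of these
    walks is its initial part. *)
Lemma edge_prefix_back_walks p n u v : bpath lam p -> se_step u v ->
  rank u < lo + n%:Z ->
  nat_of_bool (edge u v p) = (\sum_(r <- back_walks n u v) prefix (rev r) p)%N.
Proof.
move=> bp; elim: n u v => [|n IH] u v uv un.
all: have start : u \notin I ->
  nat_of_bool (edge u v p) = (\sum_(r <- [:: [:: v; u]]) prefix (rev r) p)%N.
1,3: move=> uI; rewrite big_seq1; congr nat_of_bool; apply/idP/idP;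
     last by apply: prefix_edge_last.
1,2: case/(bpath_edge bp) => a [b [-> + _]]; rewrite (negbTE uI); case: a => // _;
     by rewrite -[rev _]/[:: u; v] prefix_prefix.
  by apply: start; apply/negP => /rank_lo; move: un; lia.
rewrite /=; case: ifP => uI; last by apply: start; rewrite uI.
rewrite big_map.
transitivity (\sum_(r <- back_walks n (west u) u ++ back_walks n (north u) u)
    prefix (rev r) p * edge u v p)%N.
  have ru x : se_step x u -> rank x < lo + n%:Z.
    by move=> xu; move: un; rewrite (se_step_rank xu); lia.
  rewrite -big_distrl big_cat /= -(IH _ _ (se_step_west u)) ?(ru _ (se_step_west u)) //.
  rewrite -(IH _ _ (se_step_north u)) ?(ru _ (se_step_north u)) //.
  by have [uvp|] := boolP (edge u v p); rewrite ?muln0 // (bpath_in bp uvp uI).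
apply: eq_big_seq => r; rewrite mem_cat => rB.
have [x [s ->]] : exists x s, r = [:: u, x & s].
  by case/orP: rB => /back_walks_shape [s ->]; eexists; exists s.
by rewrite [rev [:: v, _, _ & s]]rev_cons2 prefix_edge // -rev_cons mulnb.
Qed.

(* The position intervals of the walks ending with the edge [u -> v] tile
   [0, f u v], whence the sums telescope for every function [g]. *)
Lemma sum_back_walks n u v (g : R -> R) : se_step u v -> rank u < lo + n%:Z ->
  (u \in I) || (v \in I) ->
  \sum_(r <- back_walks n u v) (g (pos true r) - g (pos false r))
  = g (f u v) - g 0.
Proof.
elim: n u v g => [|n IH] u v g uv un inI; first by rewrite big_seq1.
rewrite /=; case: ifP => uI; last by rewrite big_seq1.
rewrite big_map big_cat /=.
have E x : se_step x u ->
  \sum_(r <- back_walks n x u) (g (pos true (v :: r)) - g (pos false (v :: r)))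
  = g (pos_out u v (pos_in x u (f x u))) - g (pos_out u v (pos_in x u 0)).
  (* The induction hypothesis is used for [g] composed with the passage through [u]; hence the
     generality in [g]. *)
  move=> xu; rewrite -(IH x u (fun y => g (pos_out u v (pos_in x u y)))) ?uI ?orbT //.
    by apply: eq_big_seq => r /back_walks_shape [s ->].
  by have := se_step_rank xu; move: un; lia.
rewrite !E ?se_step_west ?se_step_north //.
(* The West sum ends at [f (west u) u], where the North sum begins; the outer ends are sent to
   [f u v] and [0]. *)
rewrite /pos_in eqxx north_eq_west addr0.
have fE := f_ge0 u (east u); have fS := f_ge0 u (south u).
have -> : pos_out u v 0 = 0.
  by rewrite /pos_out min_l //; case: ifP => _; rewrite ?subrr.
have -> : pos_out u v (f (west u) u + f (north u) u) = f u v.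
  rewrite f_cons // /pos_out min_r ?lerDl //; case/orP: uv => /eqP ->.
    by rewrite south_eq_east; lra.
  by rewrite eqxx.
lra.
Qed.

(** Paths through the edge are sorted by their past; each past contributes the length of its
    interval, and these intervals tile the edge. *)
Lemma sum_wgt_edge u v : se_step u v -> (u \in I) || (v \in I) ->
  \sum_(p <- P) wgt p *+ edge u v p = f u v.
Proof.
move=> uv inI.
have [n un] : exists n : nat, rank u < lo + n%:Z by exists `|rank u - lo|.+1; lia.
have [m vm] : exists m : nat, hi < rank v + m%:Z by exists `|hi - rank v|.+1; lia.
transitivity (\sum_(p <- P) \sum_(r <- back_walks n u v) wgt p *+ prefix (rev r) p).
  apply: eq_big_seq => p; rewrite mem_P => bp.
  by rewrite (edge_prefix_back_walks bp uv un) -sumrMnr.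
rewrite exchange_big /= -[RHS]subr0 -(sum_back_walks id uv un inI).
apply: eq_big_seq => r rB; have W := back_walks_rwalk un uv rB.
have [s Er] := back_walks_shape rB; rewrite Er in W *.
exact: (sum_wgt_prefix vm W inI).
Qed.

End Paths.
End Positions.

(** * Weights of nonkissing paths are recovered from their flow *)

Section Uniqueness.
Variables (R : realType) (lam : grid_shape).
Local Notation I := (interior lam).
Local Notation rwalk := (rwalk lam).

(** The ends of [p] are not interior, so [q] can continue beyond neither of them. *)
Lemma infix_bpath p q : bpath lam p -> bpath lam q -> infix p q -> q = p.
Proof.
move=> bp bq /infixP[a [b Eq]].
have [Wp hp _] := (bpathP lam p).1 bp; have [Wq _ _] := (bpathP lam q).1 bq.
have b0 : rev b = [::].
  move: Wq; rewrite Eq !rev_cat -catA.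
  case: (rev p) Wp hp => [|x [|y t]] // _ /negbTE /= xI.
  case/(@rwalk_cat lam (rev b)) => _ _ bI _; apply/eqP/negPn/negP => /bI.
  by rewrite xI.
have {}b0 : b = [::] by rewrite -(revK b) b0.
rewrite {}b0 cats0 in Eq; case: p Eq Wp {bp hp} => [|u [|w s]] // Eq.
have -> : rev [:: u, w & s] = rev s ++ [:: w; u] by rewrite !rev_cons -!cats1 -catA.
case/rwalk_cat => _ uI _ _; move: Wq.
rewrite Eq rev_cat !rev_cons -!cats1 -!catA /= => /rwalk_cat[_ + _ _].
rewrite uI eqxx => /esym/eqP a0.
by rewrite -[a]revK a0.
Qed.

(* The paths through the last edge of [r] whose past precedes [r], together with
   those that contain [r] when [b = true]: their weight is [pos b r]. *)
Fixpoint below (b : bool) (r : seq vertex) (q : seq vertex) : bool :=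
  if r is w :: r' then
    if r' is v :: r'' then
      edge v w q &&
      (if r'' is u :: _ then ((u != west v) && edge (west v) v q) || below b r' q
       else b)
    else false
  else false.

(** Corresponds to [vertex_pos] as [below] does to [pos]: its weight is a position on the glued
    interval at [v]. *)
Definition vertex_below b v u r (q : seq vertex) : bool :=
  ((u != west v) && edge (west v) v q) || below b [:: v, u & r] q.

Lemma below_consE b w v u r q :
  below b [:: w, v, u & r] q = edge v w q && vertex_below b v u r q.
Proof. by []. Qed.

Lemma below_edge b w v r q : below b [:: w, v & r] q -> edge v w q.
Proof. by case/andP. Qed.

(** The first half of a kiss, completed when [q] leaves [v] to the South and [q'] to the East. *)
Definition diverging v (q q' : seq vertex) : Prop := exists y s,
  [/\ last y s = v, segment lam (y :: s), enters west q (y :: s)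
    & enters north q' (y :: s)].

Lemma diverging_rcons u v q q' : bpath lam q -> bpath lam q' -> v \in I ->
  edge u v q -> edge u v q' -> diverging u q q' -> diverging v q q'.
Proof.
move=> bq bq' vI uv uv' [y [s [ys sg ent ent']]]; exists y, (rcons s v).
have G z p : bpath lam p -> edge u v p -> infix [:: z, y & s] p -> infix [:: z, y & rcons s v] p.
  move=> bp e i; have E : [:: z, y & s] = rcons (z :: belast y s) u.
    by rewrite rcons_cons -ys -lastI.
  rewrite -!rcons_cons E -cats1; apply: infix_glue => //; last by rewrite -E.
  exact/se_sorted_uniq/(bpath_sorted bp).
split; rewrite ?last_rcons //; [|exact: G..].
have /and3P[_ al so] := sg.
rewrite /segment -rcons_cons all_rcons al andbT; apply/and3P; split=> //.
by rewrite /= rcons_path ys (edge_se (bpath_sorted bq) uv) andbT; exact: so.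
Qed.

Lemma below_diverging_edge b v u r q q' x x' : bpath lam q -> bpath lam q' ->
  se_step u v -> v \in I -> edge x v q -> edge x' v q' ->
  vertex_below b v u r q -> ~~ vertex_below b v u r q' ->
  diverging v q q' \/ [/\ below b [:: v, u & r] q, ~~ below b [:: v, u & r] q',
     edge u v q & edge u v q'].
Proof.
move=> bq bq' uv vI xv xv' Bq; rewrite /vertex_below negb_or => /andP[Wq' Bq'].
have [sq sq'] := (bpath_sorted bq, bpath_sorted bq').
have dv : edge (west v) v q -> edge (north v) v q' -> diverging v q q'.
  by move=> Wq Nq'; exists v, [::]; split; rewrite ?/segment /= ?vI.
have := se_stepP (edge_se sq' xv'); have [uW|uW] := eqVneq u (west v).
  move: Bq; rewrite /vertex_below uW eqxx /= => Bq; have uq := below_edge Bq.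
  by case=> Ex; rewrite Ex in xv'; [right; rewrite uW in Bq' *| left; apply: dv].
rewrite uW /= in Wq'; case=> Ex; rewrite Ex in xv'; first by rewrite xv' in Wq'.
move: Bq; rewrite /vertex_below uW /=; case/orP => [Wq|Bq]; first by left; apply: dv.
right; split=> //; first exact: below_edge Bq.
by case: (se_stepP uv) uW => -> //; rewrite eqxx.
Qed.

(** Follow [r] backwards as long as both paths use its edges. Where they separate, [q] comes from
    the West and [q'] from the North, since only [q] is counted. *)
Lemma below_diverging b v u r q q' x x' : bpath lam q -> bpath lam q' ->
  rwalk [:: v, u & r] -> v \in I -> edge x v q -> edge x' v q' ->
  vertex_below b v u r q -> ~~ vertex_below b v u r q' -> diverging v q q'.
Proof.
move=> bq bq'; elim: r v u x x' => [|t r IH] v u x x' /andP[uv W] vI xv xv' Bq Bq'.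
all: have [//|[{}Bq {}Bq' uq uq']] := below_diverging_edge bq bq' uv vI xv xv' Bq Bq'.
  by move: Bq Bq'; rewrite /= uq uq' /= => ->.
have /andP[uI {}W] := W.
have [y yq] := bpath_pred bq uq uI; have [y' yq'] := bpath_pred bq' uq' uI.
apply: (diverging_rcons bq bq' vI uq uq'); apply: (IH _ _ _ _ W uI yq yq').
  by move: Bq; rewrite below_consE => /andP[].
by move: Bq'; rewrite below_consE uq'.
Qed.

Lemma diverging_kissing v q q' : bpath lam q -> bpath lam q' -> diverging v q q' ->
  edge v (south v) q -> edge v (east v) q' -> kissing lam q q'.
Proof.
move=> bq bq' [y [s [ys sg ent ent']]] Sq Eq'; exists (y :: s) => //.
have G z p w : bpath lam p -> edge v w p -> infix [:: z, y & s] p -> infix (rcons (y :: s) w) p.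
  move=> bp e i; have E : [:: z, y & s] = rcons (z :: belast y s) v.
    by rewrite rcons_cons -ys -lastI.
  have H : infix ([:: z, y & s] ++ [:: w]) p.
    rewrite E; apply: infix_glue => //; last by rewrite -E.
    exact/se_sorted_uniq/(bpath_sorted bp).
  by apply: infix_trans H; rewrite -cats1 -[z :: _]cat1s -catA infix_catl // infix_refl.
by rewrite /kiss_along ent ent' /leaves ys (G _ _ _ bq Sq ent) (G _ _ _ bq' Eq' ent').
Qed.

Lemma infix_edge p s u v : bpath lam p ->
  infix (rcons (rcons s u) v) p = infix (rcons s u) p && edge u v p.
Proof.
move=> bp; have up : uniq p by apply/se_sorted_uniq/(bpath_sorted bp).
apply/idP/andP => [|[su uv]].
  case/infixP=> a [b ->]; split; apply/infixP.
    by exists a, (v :: b); rewrite -!cats1 -!catA.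
  by exists (a ++ s), b; rewrite -!cats1 -!catA.
by rewrite -[rcons _ v]cats1; apply: infix_glue.
Qed.

(** A path containing [r] enters each vertex as [r] does, so its past does not precede [r]. *)
Lemma below_true r q : bpath lam q -> (1 < size r)%N ->
  nat_of_bool (below true r q) = (below false r q + infix (rev r) q)%N.
Proof.
move=> bq; have sq := bpath_sorted bq.
elim: r => [|w [|v [|u r]] IH] // _; first by rewrite /= andbT andbF.
have {}IH := IH isT.
rewrite !below_consE /vertex_below.
have -> : infix (rev [:: w, v, u & r]) q = edge v w q && infix (rev [:: v, u & r]) q.
  by rewrite rev_cons2 infix_edge // -rev_cons andbC.
case: (edge v w q) => //; rewrite !andTb.
have [/andP[uW Wq]|_] := boolP (_ && _); last exact: IH.
have [/below_edge uq|nb] := boolP (below true [:: v, u & r] q).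
  by rewrite (edge_in_inj sq uq Wq) eqxx in uW.
by move: IH; rewrite (negbTE nb) orTb; case: (infix _ _); rewrite ?addn1.
Qed.

Variable P : seq (seq vertex).
Hypothesis P_uniq : uniq P.
Hypothesis P_bpath : forall p : seq vertex, p \in P -> bpath lam p.
Variable c : seq vertex -> R.
Hypothesis c_ge0 : forall p, 0 <= c p.
Hypothesis c_nonkissing : forall p q : seq vertex, p \in P -> q \in P -> p != q ->
  0 < c p -> 0 < c q -> ~ kissing lam p q.

Definition weight (X : pred (seq vertex)) : R := \sum_(p <- P) c p *+ X p.

Definition flow (u v : vertex) : R := weight (edge u v).

Lemma eq_weight (X Y : pred (seq vertex)) : (forall p, p \in P -> c p *+ X p = c p *+ Y p) ->
  weight X = weight Y.
Proof. by move=> H; apply: eq_big_seq. Qed.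

Lemma le_weight (X Y : pred (seq vertex)) : (forall p, p \in P -> X p -> Y p) ->
  weight X <= weight Y.
Proof.
move=> H; rewrite /weight big_seq [leRHS]big_seq; apply: ler_sum => p pP.
by have := H p pP; case: (X p) => [->|_] //; rewrite mulrn_wge0.
Qed.

Lemma weight_split (X Y Z : pred (seq vertex)) :
  (forall p, p \in P -> nat_of_bool (X p) = (Y p + Z p)%N) ->
  weight X = weight Y + weight Z.
Proof.
by move=> H; rewrite -big_split; apply: eq_big_seq => p /H ->; rewrite mulrnDr.
Qed.

Lemma weight_vertex_below b v u r :
  weight (vertex_below b v u r) = pos_in flow u v (weight (below b [:: v, u & r])).
Proof.
rewrite /pos_in; case: eqP => [->|/eqP uW].
  by apply: eq_weight => p _; rewrite /vertex_below eqxx.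
apply: weight_split => p /P_bpath bp; rewrite /vertex_below uW /=.
have [Wp|] //= := boolP (edge (west v) v p).
case: (boolP (_ && _)) => // /andP[up _].
by rewrite (edge_in_inj (bpath_sorted bp) up Wp) eqxx in uW.
Qed.

Lemma vertex_below_in b v u r q : vertex_below b v u r q -> exists x, edge x v q.
Proof. by case/orP => [/andP[_ ?]|/below_edge]; [exists (west v) | exists u]. Qed.

(** Nonkissing paths leave [v] in the order in which they arrive, so the counted paths fill the East
    edge first; this is the minimum in [pos_out]. *)
Lemma weight_below_out b w v u r : rwalk [:: v, u & r] -> v \in I -> se_step v w ->
  weight (below b [:: w, v, u & r])
  = pos_out flow v w (weight (vertex_below b v u r)).
Proof.
move=> W vI vw; set X := vertex_below b v u r.
pose XE q := edge v (east v) q && X q; pose XS q := edge v (south v) q && X q.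
have XES : weight X = weight XE + weight XS.
  apply: weight_split => p /P_bpath bp; rewrite /XE /XS.
  have [/vertex_below_in [x xv]|] := boolP (X p); last by rewrite !andbF.
  by rewrite !andbT (bpath_out bp xv vI).
suff H : weight XE = Num.min (weight X) (flow v (east v)).
  rewrite /pos_out -H; case/orP: vw => /eqP -> ; last by rewrite eqxx.
  by rewrite south_eq_east XES addrC addKr.
have XE_flow : weight XE <= flow v (east v) by apply: le_weight => p _ /andP[].
have XE_X : weight XE <= weight X by apply: le_weight => p _ /andP[].
(* If a counted path of positive weight goes South, an uncounted one going East would kiss it, so
   the whole East flow is counted. Otherwise all the counted weight goes East. *)
have [[q [qP cq Xq Sq]]|none] :=
  pselect (exists q, [/\ q \in P, 0 < c q, X q & edge v (south v) q]).
  suff E : weight XE = flow v (east v) by rewrite min_r // -E.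
  apply: eq_weight => p pP; have [Ep|] /= := boolP (edge v (east v) p).
  2: by rewrite /XE => /negbTE ->.
  rewrite /XE Ep /=; have [//|Xp] := boolP (X p).
  have := c_ge0 p; rewrite le_eqVlt => /orP[/eqP <-|cp]; first by rewrite !mul0rn.
  have [x xq] := vertex_below_in Xq.
  have [y yp] := bpath_pred (P_bpath pP) Ep vI.
  have qp : q != p by apply/eqP => E; rewrite -E Xq in Xp.
  case: (c_nonkissing qP pP qp cq cp).
  apply: (diverging_kissing (P_bpath qP) (P_bpath pP) _ Sq Ep).
  exact: (below_diverging (P_bpath qP) (P_bpath pP) W vI xq yp Xq Xp).
have XS0 : weight XS = 0.
  apply: big1_seq => p /= pP; case: (boolP (XS p)) => // /andP[Sp Xp].
  have := c_ge0 p; rewrite le_eqVlt => /orP[/eqP <-|cp]; first by rewrite mul0rn.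
  by case: none; exists p.
by rewrite XES XS0 addr0 min_l.
Qed.

Lemma weight_below b r : rwalk r -> weight (below b r) = pos flow b r.
Proof.
elim: r => [|w [|v [|u r]] IH] //.
  move=> _ /=; rewrite -/(edge v w); case: b {IH}; rewrite ?mulr1n ?mulr0n.
    by apply: eq_weight => p _; rewrite andbT.
  by apply: big1_seq => p _; rewrite andbF.
move=> /andP[vw /andP[vI W]].
by rewrite weight_below_out // weight_vertex_below (IH W).
Qed.

(** For the full path, [below true] and [below false] differ only by the paths containing [p], that
    is by [p] itself. *)
Lemma weight_bpath p : p \in P -> c p = wgt flow p.
Proof.
move=> pP; have bp := P_bpath pP; have [W _ sz] := (bpathP lam p).1 bp.
rewrite /wgt -!weight_below //.
apply/esym/eqP; rewrite subr_eq; apply/eqP.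
rewrite (@weight_split _ (pred1 p) (below false (rev p))).
  congr (_ + _); rewrite /weight (bigD1_seq p) //= eqxx mulr1n big1 ?addr0 //.
  by move=> q /negbTE ->.
move=> q qP; rewrite below_true ?size_rev ?(ltnW sz) //; last exact: P_bpath.
rewrite addnC revK; congr (nat_of_bool _ + _)%N.
apply/idP/eqP => [|->]; last exact: infix_refl.
by apply: infix_bpath => //; exact: P_bpath.
Qed.

End Uniqueness.

(** * Finiteness of the set of paths, g-vectors through edges, and straight paths *)

Section BoundaryPaths.
Variables (R : realType) (lam : grid_shape).
Local Notation I := (interior lam).
Local Notation gvec := (gvec R lam).

Fixpoint se_paths (n : nat) (v : vertex) : seq (seq vertex) :=
  if n is n'.+1 then
    [:: v] :: map (cons v) (se_paths n' (east v) ++ se_paths n' (south v))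
  else [::].

Lemma mem_se_paths n v s : path se_step v s -> (size s < n)%N -> v :: s \in se_paths n v.
Proof.
elim: n v s => [|n IH] v [|w s] //=; first by rewrite inE eqxx.
move=> /andP[vw pa] sz; rewrite inE; apply/orP; right; apply: map_f.
by rewrite mem_cat; case/orP: vw => /eqP E; rewrite -E IH ?orbT.
Qed.

Lemma bpath_lam p : bpath lam p -> {subset p <= lam}.
Proof.
move=> bp; have [] := (bpathP lam p).1 bp; case: p bp => [|u [|w s]] // bp _ _ _ x.
move: bp => /andP[/and4P[uB al lB _] _].
rewrite inE => /orP[/eqP ->|]; first by case/fsetDP: uB.
rewrite lastI mem_rcons inE => /orP[/eqP ->|xs]; first by case/fsetDP: lB.
by have /interior_lam [] := allP al x xs.
Qed.

(** A path consists of distinct vertices of [lam], which bounds its length. *)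
Lemma bpath_enum : exists2 P : seq (seq vertex), uniq P &
  forall p : seq vertex, (p \in P) = bpath lam p.
Proof.
exists (undup (filter (bpath lam) (flatten (map (se_paths (size lam).+1) lam)))).
  exact: undup_uniq.
move=> p; rewrite mem_undup mem_filter; case: (boolP (bpath lam p)) => //= bp.
have pl := bpath_lam bp; have sp := bpath_sorted bp.
case: p bp pl sp => [|u s] bp pl sp; first by case/andP: bp.
apply/flattenP; exists (se_paths (size lam).+1 u).
  by apply: map_f; apply: pl; rewrite mem_head.
apply: mem_se_paths => //; rewrite ltnS.
by apply: ltnW; apply: (@uniq_leq_size _ (u :: s)); [apply: se_sorted_uniq | exact: pl].
Qed.

Lemma rank_bounds (s : seq vertex) : exists lo hi : int,
  forall v, v \in s -> lo <= rank v <= hi.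
Proof.
elim: s => [|w s [lo [hi H]]]; first by exists 0, 0.
exists (Num.min lo (rank w)), (Num.max hi (rank w)) => v.
by rewrite inE => /orP[/eqP ->|/H]; lia.
Qed.

Definition straight p := horizontal p || vertical p.

Lemma straight_edge d p u v : sorted [rel u v | v == d u] p -> edge u v p -> v = d u.
Proof.
by move=> sp uv; have := infix_sorted uv sp; rewrite /= andbT => /eqP.
Qed.

Lemma horizontal_edge p v : horizontal p ->
  (edge (north v) v p = false) * (edge v (south v) p = false).
Proof.
move=> hp; split; apply/negP => /(straight_edge hp) E.
  by have := south_eq_east (north v); rewrite south_north -E eqxx.
by have := south_eq_east v; rewrite E eqxx.
Qed.

Lemma vertical_edge p v : vertical p ->
  (edge (west v) v p = false) * (edge v (east v) p = false).
Proof.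
move=> hp; split; apply/negP => /(straight_edge hp) E.
  by have := south_eq_east (west v); rewrite east_west -E eqxx.
by have := south_eq_east v; rewrite E eqxx.
Qed.

(** The two differences agree by conservation at [v]; they are nonzero exactly when [p] turns
    there. *)
Lemma gvecE p (v : I) : bpath lam p ->
  (gvec p v = (edge (val v) (east (val v)) p)%:R - (edge (west (val v)) (val v) p)%:R) *
  (gvec p v = (edge (north (val v)) (val v) p)%:R - (edge (val v) (south (val v)) p)%:R).
Proof.
move=> bp; have sp := bpath_sorted bp; have := bpath_through bp (valP v).
rewrite ffunE /= -!/(edge _ _ _).
have : edge (west (val v)) (val v) p -> edge (north (val v)) (val v) p = false.
  move=> h; apply/negP => /(edge_in_inj sp h) /esym/eqP.
  by rewrite north_eq_west.
have : edge (val v) (east (val v)) p -> edge (val v) (south (val v)) p = false.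
  move=> h; apply/negP => /(edge_out_inj sp h) /esym/eqP.
  by rewrite south_eq_east.
do 4!case: (edge _ _ _); move=> H1 H2 // _;
  rewrite ?subrr ?subr0 ?sub0r //=; by [have := H1 isT | have := H2 isT].
Qed.

Lemma gvec_straight p : bpath lam p -> straight p -> gvec p = 0.
Proof.
move=> bp; case/orP => [/horizontal_edge|/vertical_edge] st; apply/ffunP => v.
  by rewrite (gvecE v bp).2 !ffunE !(st (val v)) subrr.
by rewrite (gvecE v bp).1 !ffunE !(st (val v)) subrr.
Qed.

Lemma bpathE u w s : bpath lam [:: u, w & s] =
  [&& u \notin I, all (mem I) (belast w s), path se_step u (w :: s),
      last w s \notin I & s != [::]].
Proof.
have hE : head (0, 0) (rev [:: u, w & s]) = last w s by rewrite lastI rev_rcons.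
apply/idP/and5P => [/bpathP|[uI al st lI s0]].
  by rewrite rwalk_rev hE => -[/and3P[-> -> ->] ->]; case: (s).
by apply/bpathP; rewrite rwalk_rev hE uI al st lI; split=> //; case: (s) s0.
Qed.

(** Iterating [d] from [u] leaves the interior after finitely many steps, as [rank] grows; every
    vertex of the path is forced. *)
Lemma straight_bpath (d : vertex -> vertex) u : (forall v, se_step v (d v)) ->
  u \notin I -> d u \in I -> exists p0, forall p,
  [&& bpath lam p, sorted [rel u v | v == d u] p & edge u (d u) p] = (p == p0).
Proof.
move=> sd uI duI; have [lo [hi H]] := rank_bounds I.
have [s0 Hs0] : exists s0, forall s, [&& path [rel u v | v == d u] (d u) s,
    all (mem I) (belast (d u) s) & last (d u) s \notin I] = (s == s0).
  have [n] : exists n : nat, hi < rank (d u) + n%:Z by exists `|hi - rank (d u)|.+1; lia.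
  elim: n (d u) {uI duI} => [|n IH] v vn; have [vI|vI] := boolP (v \in I).
  - by have := H v vI; move: vn; lia.
  - by exists [::] => -[|w s] /=; rewrite ?vI // (negbTE vI) andbF.
  - have [|s0 Hs] := IH (d v); first by rewrite (se_step_rank (sd v)); move: vn; lia.
    exists (d v :: s0) => -[|w s] /=; first by rewrite vI.
    rewrite vI eqseq_cons; have [->|] //= := eqVneq w (d v); exact: Hs.
  - by exists [::] => -[|w s] /=; rewrite ?vI // (negbTE vI) andbF.
exists [:: u, d u & s0] => p; apply/idP/eqP.
  case/and3P => bp sp /(bpath_edge bp) [a [b [Ep + _]]].
  rewrite (negbTE uI); case: a Ep => // Ep _; rewrite Ep in bp sp *.
  congr [:: _, _ & _]; apply/eqP; rewrite -Hs0.
  by move: bp sp; rewrite bpathE => /and5P[_ -> _ -> _] /= /andP[_ ->].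
move=> ->; have := Hs0 s0; rewrite eqxx => /and3P[pa al lI].
have pse : path se_step u (d u :: s0).
  by rewrite /= sd; apply: sub_path pa => x y /= /eqP ->; exact: sd.
rewrite bpathE uI al lI pse /= eqxx pa /=.
rewrite -[edge _ _ _]/(prefix _ _ || _) /= !eqxx prefix0s /= andbT.
by case: (s0) lI => //=; rewrite duI.
Qed.

Lemma enters_edge d p s : enters d p s -> exists v, edge (d v) v p.
Proof.
case: s => // v s i; exists v; apply: infix_trans i.
by rewrite -[[:: d v, v & s]]/([:: d v; v] ++ s); apply: prefixW (prefix_prefix _ _).
Qed.

Lemma leaves_edge d p s : leaves d p s -> exists v, edge v (d v) p.
Proof. by case: s => // v s /infix_last i; exists (last v s). Qed.

(** Each of two kissing paths has both a horizontal and a vertical edge. *)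
Lemma straight_nonkissing p q s : straight p -> ~~ kiss_along p q s.
Proof.
move=> st; apply/negP => /orP[] /and4P[e1 e2 e3 e4].
  have [v vp] := enters_edge e1; have [w wp] := leaves_edge e2.
  by case/orP: st => [/horizontal_edge|/vertical_edge] H;
    [move: wp; rewrite (H w).2 | move: vp; rewrite (H v).1].
have [v vp] := enters_edge e3; have [w wp] := leaves_edge e4.
by case/orP: st => [/horizontal_edge|/vertical_edge] H;
  [move: vp; rewrite (H v).1 | move: wp; rewrite (H w).2].
Qed.

Lemma kiss_alongC p q s : kiss_along p q s = kiss_along q p s.
Proof. exact: orbC. Qed.

End BoundaryPaths.

(** * Every vector lies in the cone of some face *)

Section Decomposition.
Variables (R : realType) (lam : grid_shape).
Local Notation I := (interior lam).
Local Notation gvec := (gvec R lam).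

(** A path with two vertices has a single edge and is straight, so all paths of a face satisfy
    [bpath]. *)
Lemma reduced_NKP F : reduced_NK lam F <->
  (forall p, p \in F -> bpath lam p /\ ~~ straight p) /\
  (forall p q, p \in F -> q \in F -> p != q -> ~ kissing lam p q).
Proof.
split=> -[H K]; split=> // p pF.
  have [bp nh nv] := H p pF; rewrite /straight negb_or nh nv /bpath bp; split=> //.
  case: p bp nh nv {pF} => [|u [|w [|z s]]] //= /and3P[_ _]; rewrite !andbT.
  by case/orP=> /eqP ->; rewrite eqxx.
have [/andP[bp _]] := H p pF; rewrite /straight negb_or => /andP[nh nv].
by split.
Qed.

Lemma row_west (v w : vertex) :
  (w.2 == v.2) && (w.1 <= v.1) && (w != v) = (w.2 == (west v).2) && (w.1 <= (west v).1).
Proof.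
case: v w => [a b] [a' b'] /=; rewrite xpair_eqE.
by case: (b' == b) => //=; rewrite ?andbF ?andbT //; lia.
Qed.

Lemma column_north (v w : vertex) :
  (w.1 == v.1) && (v.2 <= w.2) && (w != v) = (w.1 == (north v).1) && ((north v).2 <= w.2).
Proof.
case: v w => [a b] [a' b'] /=; rewrite xpair_eqE.
by case: (a' == a) => //=; rewrite ?andbF ?andbT //; lia.
Qed.

Lemma big_fset_bpath (F : {fset seq vertex}) (P : seq (seq vertex)) (V : zmodType)
    (G : seq vertex -> V) : uniq P -> {subset F <= P} ->
  \sum_(p <- F) G p = \sum_(p <- P | p \in F) G p.
Proof.
move=> uP FP; rewrite -[RHS]big_filter; apply: perm_big; apply: uniq_perm.
- exact: fset_uniq.
- exact: filter_uniq.
- by move=> p; rewrite mem_filter; case: (boolP (p \in F)) => // /FP ->.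
Qed.

Lemma gvec_decomposition (x : gspace R lam) : exists F : {fset seq vertex},
  reduced_NK lam F /\ exists2 c : seq vertex -> R, (forall p, 0 <= c p)
    & x = \sum_(p <- F) c p *: gvec p.
Proof.
have [P uP mP] := bpath_enum lam.
have [lo [hi H]] := rank_bounds I.
have lor v : v \in I -> lo <= rank v by move=> /H /andP[].
have hir v : v \in I -> rank v <= hi by move=> /H /andP[].
(* [M] bounds all partial sums of coordinates and so keeps the flow [f] nonnegative. *)
pose M : R := \sum_(v : I) `|x v|.
have le_M (A : pred I) : `|\sum_(v : I | A v) x v| <= M.
  apply: le_trans (ler_norm_sum _ _ _) _; rewrite /M [leRHS](bigID A) /= lerDl.
  by apply: sumr_ge0 => v _; exact: normr_ge0.
(* An East edge carries [M] plus the coordinates at or West of [u] in its row, a South edge [M]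
   minus those at or North of [u] in its column. Crossing [v] adds [x v] to one and subtracts it
   from the other, whence conservation. *)
pose f (u w : vertex) : R :=
  if w == east u then M + \sum_(v : I | ((val v).2 == u.2) && ((val v).1 <= u.1)) x v
  else M - \sum_(v : I | ((val v).1 == u.1) && (u.2 <= (val v).2)) x v.
have f0 u w : 0 <= f u w.
  rewrite /f; case: ifP => _.
    have := le_M [pred v : I | ((val v).2 == u.2) && ((val v).1 <= u.1)].
    by rewrite ler_norml /= => /andP[]; lra.
  have := le_M [pred v : I | ((val v).1 == u.1) && (u.2 <= (val v).2)].
  by rewrite ler_norml /= => /andP[]; lra.
have fE (v : I) : f (val v) (east (val v)) = f (west (val v)) (val v) + x v.
  rewrite /f eqxx east_west eqxx -addrA; congr (_ + _).
  rewrite (bigD1 v) ?eqxx ?lexx //= addrC; congr (_ + _); apply: eq_bigl => w.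
  exact: row_west.
have fS (v : I) : f (val v) (south (val v)) = f (north (val v)) (val v) - x v.
  rewrite /f south_eq_east; have -> : (val v == east (north (val v))) = false.
    by rewrite -{1}(south_north (val v)) south_eq_east.
  rewrite -addrA -opprD; congr (_ - _).
  rewrite (bigD1 v) ?eqxx ?lexx //= addrC; congr (_ + _); apply: eq_bigl => w.
  exact: column_north.
have fc v : v \in I -> f (west v) v + f (north v) v = f v (east v) + f v (south v).
  by move=> vI; have := fE [` vI]%fset; have := fS [` vI]%fset => /= -> ->; lra.
pose F := [fset p in P | (0 < wgt f p) && ~~ straight p]%fset.
have inF p : (p \in F) = [&& bpath lam p, 0 < wgt f p & ~~ straight p].
  by rewrite !inE /= mP.
exists F; split.
  apply/reduced_NKP; split=> [p|p q]; rewrite !inF; first by case/and3P.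
  move=> /and3P[bp wp _] /and3P[bq wq _] _.
  exact: (wgt_nonkissing f0 fc).
exists (wgt f); first by move=> p; exact: wgt_ge0.
have FP : {subset F <= P} by move=> p; rewrite inF mP => /andP[].
rewrite (big_fset_bpath _ uP FP).
(* The paths outside [F] have weight zero or are straight, with zero g-vector. *)
have -> : \sum_(p <- P | p \in F) wgt f p *: gvec p = \sum_(p <- P) wgt f p *: gvec p.
  rewrite big_mkcond; apply: eq_big_seq => p; rewrite mP => bp; rewrite inF bp /=.
  have := wgt_ge0 f0 p.
  rewrite le_eqVlt => /orP[/eqP <-|-> /=]; first by rewrite scale0r if_same.
  by case: ifP => // /negbFE st; rewrite gvec_straight ?scaler0.
apply/ffunP => v; rewrite sum_ffunE.
transitivity (\sum_(p <- P) (wgt f p *+ edge (val v) (east (val v)) p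
    - wgt f p *+ edge (west (val v)) (val v) p)).
  rewrite sumrB !(sum_wgt_edge f0 fc uP mP lor hir) ?se_step_east ?se_step_west ?(valP v) ?orbT //.
  by rewrite fE addrC addKr.
apply: eq_big_seq => p; rewrite mP => bp; rewrite ffunE (gvecE R v bp).1.
by rewrite -[RHS]/(_ * _) mulrBr !mulr_natr.
Qed.

End Decomposition.

(** * Uniqueness of the coefficients *)

(* Straight paths have zero g-vector and kiss no path.  Adding them with the
   right weights makes the flow through every starting edge equal to [M], and
   then the flow is determined by the combination of g-vectors. *)
Section Completion.
Variables (R : realType) (lam : grid_shape).
Local Notation I := (interior lam).
Local Notation gvec := (gvec R lam).
Variables (P : seq (seq vertex)) (F : {fset seq vertex}) (c : seq vertex -> R) (M : R).
Hypothesis P_uniq : uniq P.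
Hypothesis mem_P : forall p : seq vertex, (p \in P) = bpath lam p.
Hypothesis F_face : reduced_NK lam F.
Hypothesis c_ge0 : forall p, 0 <= c p.
Hypothesis c_supp : forall p : seq vertex, p \notin F -> c p = 0.
Hypothesis M_ge : \sum_(p <- P) c p <= M.

(** The amount that the first edge lacks to carry [M], placed on the path going straight in
    direction [d]. *)
Definition padding (d : vertex -> vertex) (p : seq vertex) : R :=
  if sorted [rel u v | v == d u] p
  then M - flow P c (head (0, 0) p) (d (head (0, 0) p)) else 0.

Definition completion p : R := c p + (padding east p + padding south p).

Lemma padding_ge0 d p : 0 <= padding d p.
Proof.
rewrite /padding; case: ifP => // _; rewrite subr_ge0; apply: le_trans M_ge.
by apply: ler_sum => q _; case: (edge _ _ _); rewrite ?mulr1n ?mulr0n.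
Qed.

Lemma completion_ge0 p : 0 <= completion p.
Proof. by rewrite addr_ge0 // addr_ge0 // padding_ge0. Qed.

Lemma completion_nonstraight p : ~~ straight p -> completion p = c p.
Proof.
by rewrite negb_or => /andP[/negbTE h /negbTE v]; rewrite /completion /padding
  -/(horizontal p) -/(vertical p) h v !addr0.
Qed.

Lemma completion_nonkissing p q : p \in P -> q \in P -> p != q ->
  0 < completion p -> 0 < completion q -> ~ kissing lam p q.
Proof.
move=> _ _ pq wp wq; have [sp|np] := boolP (straight p).
  by case=> s _; apply/negP/straight_nonkissing.
have [sq|nq] := boolP (straight q).
  by case=> s _; rewrite kiss_alongC; apply/negP/straight_nonkissing.
move: wp wq; rewrite !completion_nonstraight // => wp wq.
have inF r : 0 < c r -> r \in F.
  by move=> cr; apply: contraLR cr => /c_supp ->; rewrite ltxx.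
by have [_] := (reduced_NKP lam F).1 F_face; apply; rewrite ?inF.
Qed.

Lemma padding_flow d u : (forall v, se_step v (d v)) -> u \notin I -> d u \in I ->
  \sum_(p <- P) padding d p *+ edge u (d u) p = M - flow P c u (d u).
Proof.
move=> sd uI duI; have [p0 H] := straight_bpath sd uI duI.
have /and3P[bp0 sp0 ep0] : [&& bpath lam p0, sorted [rel u v | v == d u] p0 & edge u (d u) p0].
  by rewrite H.
rewrite (bigD1_seq p0) ?mem_P //= big1_seq ?addr0.
  rewrite ep0 mulr1n /padding sp0; congr (_ - flow P c _ _).
    have [a [b [-> + _]]] := bpath_edge bp0 ep0.
    by rewrite (negbTE uI); case: a.
  have [a [b [-> + _]]] := bpath_edge bp0 ep0.
  by rewrite (negbTE uI); case: a.
move=> p /andP[pp0]; rewrite mem_P => bp; rewrite /padding.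
case: ifP => [sp|_]; last exact: mul0rn.
have := H p; rewrite bp sp (negbTE pp0) /= => ->; exact: mulr0n.
Qed.

Lemma padding_flow0 d u v : v != d u -> \sum_(p <- P) padding d p *+ edge u v p = 0.
Proof.
move=> vd; apply: big1_seq => p _; rewrite /padding.
case: ifP => [sp|_]; last exact: mul0rn.
by case: (boolP (edge u v p)) => // /(straight_edge sp) /eqP; rewrite (negbTE vd).
Qed.

Lemma flow_completion_start u v : u \notin I -> v \in I -> se_step u v ->
  flow P completion u v = M.
Proof.
move=> uI vI uv.
have -> : flow P completion u v = flow P c u v +
   (\sum_(p <- P) padding east p *+ edge u v p + \sum_(p <- P) padding south p *+ edge u v p).
  rewrite -!big_split; apply: eq_bigr => p _ /=.
  by rewrite /completion !mulrnDl.
case/orP: uv vI => /eqP -> vI.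
  rewrite padding_flow0 ?south_eq_east // padding_flow //; last exact: se_step_south.
  by rewrite add0r addrC subrK.
rewrite padding_flow ?padding_flow0 //; last exact: se_step_east.
  by rewrite addr0 addrC subrK.
by rewrite eq_sym south_eq_east.
Qed.

(** Serves to compare two completed flows as functions on all pairs of vertices. *)
Lemma flow_completion_out u v : ~~ ((u \in I) || (v \in I)) || ~~ se_step u v ->
  flow P completion u v = 0.
Proof.
move=> H; apply: big1_seq => p /=; rewrite mem_P => bp.
case: (boolP (edge u v p)) => // uv; move: H.
rewrite (edge_se (bpath_sorted bp) uv) orbF.
have [a [b [Ep -> ->]]] := bpath_edge bp uv.
by case/andP: bp => _; rewrite Ep; case: (a); case: (b).
Qed.

Lemma sum_completion : \sum_(p <- P) completion p *: gvec p = \sum_(p <- F) c p *: gvec p.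
Proof.
have [FH _] := (reduced_NKP lam F).1 F_face.
rewrite (big_fset_bpath _ P_uniq); last by move=> p /FH []; rewrite mem_P.
rewrite [RHS]big_mkcond; apply: eq_big_seq => p; rewrite mem_P => bp.
have [sp|np] := boolP (straight p).
  by rewrite gvec_straight // !scaler0 if_same.
rewrite completion_nonstraight //; case: ifP => // /negbT /c_supp ->.
by rewrite scale0r.
Qed.

(** The flow out of [v] is determined by the flow into [v] and the coordinate [x v]. *)
Lemma flow_completion_step (v : I) (x : gspace R lam) :
  x = \sum_(p <- F) c p *: gvec p ->
  (flow P completion (val v) (east (val v)) =
    flow P completion (west (val v)) (val v) + x v) *
  (flow P completion (val v) (south (val v)) =
    flow P completion (north (val v)) (val v) - x v).
Proof.
rewrite -sum_completion => ->; rewrite sum_ffunE.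
split.
  apply/eqP; rewrite addrC -subr_eq; apply/eqP; rewrite -sumrB.
  apply: eq_big_seq => p; rewrite mem_P => bp; rewrite ffunE (gvecE R v bp).1.
  by rewrite -[RHS]/(_ * _) mulrBr !mulr_natr.
apply/eqP; rewrite eq_sym subr_eq addrC -subr_eq; apply/eqP; rewrite -sumrB.
apply: eq_big_seq => p; rewrite mem_P => bp; rewrite ffunE (gvecE R v bp).2.
by rewrite -[RHS]/(_ * _) mulrBr !mulr_natr.
Qed.

Lemma completion_wgt p : p \in P -> completion p = wgt (flow P completion) p.
Proof.
move=> pP; apply: (weight_bpath P_uniq _ completion_ge0 completion_nonkissing pP).
by move=> q; rewrite mem_P.
Qed.

End Completion.

(** Both completed flows start with [M] and obey the same recursion, so they coincide, and each
    determines its weights. *)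
Lemma gvec_unique (R : realType) (lam : grid_shape) (F G : {fset seq vertex})
    (c d : seq vertex -> R) :
  reduced_NK lam F -> reduced_NK lam G ->
  (forall p, 0 <= c p) -> (forall p, 0 <= d p) ->
  (forall p : seq vertex, p \notin F -> c p = 0) ->
  (forall p : seq vertex, p \notin G -> d p = 0) ->
  \sum_(p <- F) c p *: gvec R lam p = \sum_(p <- G) d p *: gvec R lam p ->
  c =1 d.
Proof.
move=> FF FG c0 d0 cF dG E p.
have [P uP mP] := bpath_enum lam; have [lo [hi H]] := rank_bounds (interior lam).
(* A common [M], large enough to complete both families. *)
pose M := \sum_(p <- P) c p + \sum_(p <- P) d p.
have cM : \sum_(p <- P) c p <= M by rewrite lerDl; apply: sumr_ge0.
have dM : \sum_(p <- P) d p <= M by rewrite lerDr; apply: sumr_ge0.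
pose fc := flow P (completion P c M); pose fd := flow P (completion P d M).
have fcd u v : (u \in interior lam) || (v \in interior lam) -> se_step u v -> fc u v = fd u v.
  have [n] : exists n : nat, rank u < lo + n%:Z by exists `|rank u - lo|.+1; lia.
  elim: n u v => [|n IH] u v un; have [uI|uI] := boolP (u \in interior lam) => /=.
  - by have := H u uI; move: un; lia.
  - by move=> vI uv; rewrite /fc /fd !(flow_completion_start _ _ uP mP).
  - move=> _ uv.
    have [cE cS] := flow_completion_step M uP mP FF cF [` uI]%fset erefl.
    have [dE dS] := flow_completion_step M uP mP FG dG [` uI]%fset erefl.
    have un' x : se_step x u -> rank x < lo + n%:Z.
      by move=> xu; move: un; rewrite (se_step_rank xu); lia.
    have W : fc (west u) u = fd (west u) u.
      by apply: IH; rewrite ?uI ?orbT ?se_step_west // un' ?se_step_west.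
    have N : fc (north u) u = fd (north u) u.
      by apply: IH; rewrite ?uI ?orbT ?se_step_north // un' ?se_step_north.
    case/orP: uv => /eqP ->.
      by rewrite /= in cS dS; rewrite /fc /fd cS dS -/(fc _ _) -/(fd _ _) N E.
    by rewrite /= in cE dE; rewrite /fc /fd cE dE -/(fc _ _) -/(fd _ _) W E.
  - by move=> vI uv; rewrite /fc /fd !(flow_completion_start _ _ uP mP).
have {}fcd : fc = fd.
  apply/funext => u; apply/funext => v.
  have [/andP[inI uv]|out] := boolP (((u \in interior lam) || (v \in interior lam)) && se_step u v).
    exact: fcd.
  by rewrite /fc /fd !(flow_completion_out _ _ mP) // -negb_and.
have [pF|pF] := boolP ((p \in F) || (p \in G)); last first.
  by move: pF; rewrite negb_or => /andP[/cF -> /dG ->].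
have [bp np] : bpath lam p /\ ~~ straight p.
  have [FH _] := (reduced_NKP lam F).1 FF; have [GH _] := (reduced_NKP lam G).1 FG.
  by case/orP: pF; [apply: FH | apply: GH].
rewrite -(completion_nonstraight P c M np) -(completion_nonstraight P d M np).
rewrite (completion_wgt uP mP FF c0 cF cM) ?mP //.
by rewrite (completion_wgt uP mP FG d0 dG dM) ?mP // -/fc -/fd fcd.
Qed.

(** * From unique nonnegative combinations to a complete simplicial fan *)

(* If every vector is, in exactly one way, a combination with positive
   coefficients of the vectors of a face, the cones form a complete fan. *)
Section ConesOfComplex.
Variables (R : realType) (E : vectType R) (T : choiceType) (g : T -> E).
Variable K : set {fset T}.
Hypothesis K_fin : finite_set K.
Hypothesis K_sub : forall F G, K F -> (G `<=` F)%fset -> K G.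
Hypothesis K_unique : forall (F G : {fset T}) (c d : T -> R), K F -> K G ->
  (forall p, 0 <= c p) -> (forall p, 0 <= d p) ->
  (forall p, p \notin F -> c p = 0) -> (forall p, p \notin G -> d p = 0) ->
  \sum_(p <- F) c p *: g p = \sum_(p <- G) d p *: g p -> c =1 d.

Let C (F : {fset T}) : set E := cone [fset g p | p in F]%fset.

Lemma sum_delta (F : {fset T}) p (a : R) : p \in F ->
  \sum_(q <- F) (a *+ (q == p)) *: g q = a *: g p.
Proof.
move=> pF; rewrite (bigD1_seq p) ?fset_uniq //= eqxx big1 ?addr0 // => q /negbTE ->.
by rewrite scale0r.
Qed.

Lemma sum_fsub (F G : {fset T}) (c : T -> R) : (G `<=` F)%fset ->
  (forall p, p \notin G -> c p = 0) ->
  \sum_(p <- G) c p *: g p = \sum_(p <- F) c p *: g p.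
Proof. by move=> GF c0; apply: big_fset_incl => // p _ /c0 ->; rewrite scale0r. Qed.

Lemma gen_inj F : K F -> {in F &, injective g}.
Proof.
move=> KF p q pF qF E'; apply/eqP.
have /(_ p) : (fun x => 1 *+ (x == p) : R) =1 (fun x => 1 *+ (x == q)).
  apply: (K_unique KF KF) => [x|x|x|x|]; rewrite ?mulrn_wge0 //.
  - by move=> xF; case: eqP => // xp; rewrite xp pF in xF.
  - by move=> xF; case: eqP => // xp; rewrite xp qF in xF.
  - by rewrite !sum_delta // E'.
by rewrite eqxx; case: eqP => // _ /eqP; rewrite oner_eq0.
Qed.

Lemma gen_neq0 F p : K F -> p \in F -> g p != 0.
Proof.
move=> KF pF; apply/eqP => g0.
have /(_ p) : (fun x => 1 *+ (x == p) : R) =1 (fun=> 0).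
  apply: (K_unique KF KF) => [x|x|x|x|]; rewrite ?mulrn_wge0 //.
    by move=> xF; case: eqP => // xp; rewrite xp pF in xF.
by rewrite sum_delta // g0 scaler0 big1 // => x _; rewrite scale0r.
by rewrite eqxx => /eqP; rewrite oner_eq0.
Qed.

(** [cone] has coefficients on vectors; they move to the indices because [g] is injective on a
    face. *)
Lemma mem_coneP F x : K F -> C F x <-> exists c : T -> R,
  [/\ forall p, 0 <= c p, forall p, p \notin F -> c p = 0 & x = \sum_(p <- F) c p *: g p].
Proof.
move=> KF; have gi := gen_inj KF; split=> [[c c0 ->]|[c [c0 cF ->]]].
  exists (fun p => if p \in F then c (g p) else 0); split=> [p|p /negbTE ->|] //.
    by case: ifP.
  rewrite big_imfset //=; apply: eq_big_seq => p; rewrite /= => ->.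
  by [].
exists (fun v => \sum_(p <- F | g p == v) c p); first by move=> v; apply: sumr_ge0.
rewrite big_imfset //=; apply: eq_big_seq => p pF; congr (_ *: _).
rewrite big_mkcond (bigD1_seq p) ?fset_uniq //= eqxx big1_seq ?addr0 //= => q /andP[qp qF].
by case: eqP => // /gi => /(_ qF pF) /eqP; rewrite (negbTE qp).
Qed.

(** The positive and negative parts of [a] give two nonnegative combinations of the same vector,
    hence are equal. *)
Lemma gen_independent F (a : T -> R) : K F -> \sum_(p <- F) a p *: g p = 0 ->
  forall p, p \in F -> a p = 0.
Proof.
move=> KF a0 p pF.
have mx (y : R) : Num.max y 0 - Num.max (- y) 0 = y.
  case: (lerP 0 y) => y0; first by rewrite max_r ?oppr_le0 // subr0.
  by rewrite max_l ?oppr_ge0 ?ltW // sub0r opprK.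
pose c x := if x \in F then Num.max (a x) 0 else 0.
pose d x := if x \in F then Num.max (- a x) 0 else 0.
have : c =1 d.
  apply: (K_unique KF KF) => [x|x|x|x|]; rewrite /c /d.
  - by case: ifP => // _; rewrite le_max lexx orbT.
  - by case: ifP => // _; rewrite le_max lexx orbT.
  - by move/negbTE->.
  - by move/negbTE->.
  - apply/eqP; rewrite -subr_eq0 -sumrB -[X in _ == X]a0; apply/eqP.
    apply: eq_big_seq => x xF; rewrite xF -scalerBl; congr (_ *: _).
    exact: mx.
by move/(_ p); rewrite /c /d pF => cd; rewrite -[LHS]mx cd subrr.
Qed.

Lemma gen_free F : K F -> free [seq g p | p <- enum_fset F].
Proof.
move=> KF; have inj := gen_independent KF.
apply/(@freeP _ _ _ (in_tuple _)) => k k0 i.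
have si : (i < size (enum_fset F))%N by rewrite -(size_map g (enum_fset F)) ltn_ord.
have [p0 _] : exists p0, p0 \in F.
  by apply/fset0Pn; rewrite -cardfs_gt0; exact: leq_ltn_trans si.
(* [k] transported from list positions to elements; [insub] fails exactly outside [F]. *)
pose a p := if insub (index p (enum_fset F)) is Some j then k j else 0.
have aE (j : 'I_(size [seq g p | p <- enum_fset F])) : a (nth p0 (enum_fset F) j) = k j.
  have sj : (j < size (enum_fset F))%N by rewrite -(size_map g (enum_fset F)) ltn_ord.
  by rewrite /a index_uniq ?fset_uniq // valK.
rewrite -aE; apply: inj; last exact: mem_nth.
rewrite (big_nth p0) -[RHS]k0 -(size_map g (enum_fset F)) big_mkord; apply: eq_bigr => j _.
by rewrite aE (nth_map p0) // -(size_map g (enum_fset F)) ltn_ord.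
Qed.

Lemma gen_functional F (a : T -> R) : K F ->
  exists f : {linear E -> R^o}, forall p, p \in F -> f (g p) = a p.
Proof.
move=> KF;
have [f] := linear_of_free (rT := R^o)
  [seq g p | p <- enum_fset F] [seq a p | p <- enum_fset F].
rewrite !size_map => /(_ (gen_free KF) erefl) H; exists f => p pF.
by move: H; rewrite -map_comp => /eq_in_map /(_ p pF).
Qed.

(** [f] of a combination is a sum of nonnegative terms, so it vanishes only if every generator with
    [f (g p) != 0] has coefficient zero. *)
Lemma cone_face F (f : {linear E -> R^o}) : K F ->
  (forall p, p \in F -> 0 <= f (g p)) ->
  [set x | C F x /\ f x = 0]%classic = C [fset p in F | f (g p) == 0]%fset.
Proof.
move=> KF f0; set G := [fset p in F | _]%fset.
have GF : (G `<=` F)%fset by apply/fsubsetP => p; rewrite !inE => /andP[].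
have KG := K_sub KF GF.
apply/seteqP; split=> x /=.
  case=> /(mem_coneP _ KF)[c [c0 cF ->]] fx; apply/(mem_coneP _ KG).
  have cG p : p \notin G -> c p = 0.
    rewrite !inE /= negb_and; have [pF /= fp|/cF //] := boolP (p \in F).
    move: fx; rewrite linear_sum (bigD1_seq p) ?fset_uniq //= linearZ /=.
    move=> /eqP; rewrite paddr_eq0.
    - by case/andP; rewrite mulf_eq0 (negbTE fp) orbF => /eqP.
    - by apply: mulr_ge0; [exact: c0 | exact: f0].
    - rewrite big_seq_cond; apply: sumr_ge0 => q /andP[qF _]; rewrite linearZ /=.
      by apply: mulr_ge0; [exact: c0 | exact: f0].
  by exists c; split=> //; rewrite (sum_fsub GF).
move=> /(mem_coneP _ KG)[c [c0 cG ->]]; split.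
  apply/(mem_coneP _ KF); exists c; split=> //; last exact: sum_fsub.
  by move=> p pF; apply: cG; apply: contra pF; apply: (fsubsetP GF).
rewrite linear_sum big1_seq // => p /=; rewrite !inE => /andP[_ /eqP fp].
by rewrite linearZ /= fp scaler0.
Qed.

Lemma gen_in_cone F p : K F -> p \in F -> C F (g p).
Proof.
move=> KF pF; apply/(mem_coneP _ KF); exists (fun x => 1 *+ (x == p)); split.
- by move=> x; rewrite mulrn_wge0.
- by move=> x xF; case: eqP => // xp; rewrite xp pF in xF.
- by rewrite sum_delta // scale1r.
Qed.

Lemma face_of_coneP F D : K F -> face_of D (C F) ->
  exists2 G : {fset T}, (G `<=` F)%fset & D = C G.
Proof.
move=> KF [f [f0 ->]]; exists [fset p in F | f (g p) == 0]%fset.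
  by apply/fsubsetP => p; rewrite !inE => /andP[].
by apply: cone_face => // p pF; apply: f0; apply: gen_in_cone.
Qed.

(** By independence some functional is [0] on the generators in [G] and [1] on the others. *)
Lemma cone_face_of F G : K F -> (G `<=` F)%fset -> face_of (C G) (C F).
Proof.
move=> KF GF; have [f fE] := gen_functional (fun p => (p \notin G)%:R) KF.
have f0 p : p \in F -> 0 <= f (g p) by move=> /fE ->; rewrite ler0n.
exists f; split.
  move=> x /(mem_coneP _ KF)[c [c0 _ ->]]; rewrite linear_sum big_seq.
  by apply: sumr_ge0 => p /f0 fp; rewrite linearZ /=; apply: mulr_ge0.
rewrite cone_face //; congr C; apply/fsetP => p; rewrite !inE /=.
have [pG|pG] := boolP (p \in G).
  by rewrite (fsubsetP GF) // fE ?(fsubsetP GF) // pG eqxx.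
by have [pF|] //= := boolP (p \in F); rewrite fE // pG oner_eq0.
Qed.

(** A common vector has the same coefficients over [F] and over [G], so they vanish outside both. *)
Lemma cone_cap F G : K F -> K G -> (C F `&` C G)%classic = C (F `&` G)%fset.
Proof.
move=> KF KG; have KI := K_sub KF (fsubsetIl F G).
apply/seteqP; split=> x /=.
  case=> /(mem_coneP _ KF)[c [c0 cF xc]] /(mem_coneP _ KG)[d [d0 dG xd]].
  have cd := K_unique KF KG c0 d0 cF dG (etrans (esym xc) xd).
  apply/(mem_coneP _ KI); exists c.
  have cI p : p \notin (F `&` G)%fset -> c p = 0.
    by rewrite inE negb_and => /orP[/cF|/dG] //; rewrite cd.
  by split=> //; rewrite xc; apply/esym/sum_fsub => //; exact: fsubsetIl.
move=> /(mem_coneP _ KI)[c [c0 cI ->]].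
have cF p : p \notin F -> c p = 0.
  by move=> pF; apply: cI; rewrite inE negb_and pF.
have cG p : p \notin G -> c p = 0.
  by move=> pG; apply: cI; rewrite inE negb_and pG orbT.
split; [apply/(mem_coneP _ KF) | apply/(mem_coneP _ KG)]; exists c; split=> //.
  by apply: sum_fsub => //; exact: fsubsetIl.
by apply: sum_fsub => //; exact: fsubsetIr.
Qed.

Lemma cone_pointed F : K F -> pointed (C F).
Proof.
move=> KF x /(mem_coneP _ KF)[c [c0 cF xc]] /(mem_coneP _ KF)[d [d0 dF xd]].
rewrite xc big1_seq // => p /= pF.
have := gen_independent (a := fun p => c p + d p) KF _ pF.
have -> : \sum_(p <- F) (c p + d p) *: g p = 0.
  under eq_bigr do rewrite scalerDl.
  by rewrite big_split /= -xc -xd subrr.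
move=> /(_ erefl) /eqP; rewrite paddr_eq0 // => /andP[/eqP -> _].
by rewrite scale0r.
Qed.

Lemma cone1 p : C [fset p]%fset = cone [fset g p]%fset.
Proof.
congr cone; apply/fsetP => v; rewrite inE; apply/imfsetP/eqP => [[q /=]|->].
  by rewrite inE => /eqP -> ->.
by exists p => //=; rewrite inE.
Qed.

Lemma mem_cone1 (v x : E) : cone [fset v]%fset x -> exists2 a : R, 0 <= a & x = a *: v.
Proof. by case=> c c0 ->; exists (c v) => //; rewrite big_seq_fset1. Qed.

(** A face that is a ray is generated by a subset [G]; two generators in [G] would be multiples of
    one vector, against uniqueness. *)
Lemma cone_extreme_ray F D : K F ->
  extreme_ray D (C F) <-> exists2 p, p \in F & D = cone [fset g p]%fset.
Proof.
move=> KF; split; last first.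
  case=> p pF ->; split; last by exists (g p); rewrite // (gen_neq0 KF).
  by rewrite -cone1; apply: cone_face_of => //; rewrite fsub1set.
case=> /(face_of_coneP KF)[G GF ->] [v v0 DE]; have KG := K_sub KF GF.
have vG : C G v.
  rewrite DE; exists (fun=> 1) => [_|]; first exact: ler01.
  by rewrite big_seq_fset1 scale1r.
have [p pG] : exists p, p \in G.
  have [G0|//] := fset_0Vmem G; last by case=> p pG; exists p.
  move: vG => /(mem_coneP _ KG)[c [_ _ E']]; move: v0.
  by rewrite E' G0 big_seq_fset0 eqxx.
exists p; first exact: (fsubsetP GF).
suff -> : G = [fset p]%fset by rewrite cone1.
apply/fsetP => q; rewrite inE; apply/idP/eqP => [qG|->//].
have [a a0 pa] : exists2 a : R, 0 <= a & g p = a *: v.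
  by apply: mem_cone1; rewrite -DE; apply: gen_in_cone.
have [b b0 qb] : exists2 a : R, 0 <= a & g q = a *: v.
  by apply: mem_cone1; rewrite -DE; apply: gen_in_cone.
apply/eqP/negPn/negP => qp.
(* [b *: g p] and [a *: g q] both equal [(a * b) *: v]. *)
have /(_ q) : (fun x => b *+ (x == p)) =1 (fun x => a *+ (x == q)).
  apply: (K_unique KG KG) => [x|x|x|x|]; rewrite ?mulrn_wge0 //.
  - by move=> xG; case: eqP => // xp; rewrite xp pG in xG.
  - by move=> xG; case: eqP => // xp; rewrite xp qG in xG.
  - by rewrite !sum_delta // pa qb !scalerA mulrC.
rewrite eqxx (negbTE qp) => /esym a1; move: (gen_neq0 KG pG).
by rewrite pa -[a]mulr1n a1 scale0r eqxx.
Qed.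

Lemma complex_fan : fan [set C F | F in K]%classic.
Proof.
split.
- exact: finite_image.
- by move=> _ [F KF <-]; eexists.
- by move=> _ D [F KF <-] /(face_of_coneP KF)[G GF ->]; exists G => //; exact: K_sub GF.
- move=> _ _ [F KF <-] [G KG <-]; rewrite cone_cap //; split.
  + by exists (F `&` G)%fset => //; exact: K_sub KF (fsubsetIl F G).
  + by apply: cone_face_of => //; exact: fsubsetIl.
  + by apply: cone_face_of => //; exact: fsubsetIr.
Qed.

Lemma complex_simplicial : simplicial_fan [set C F | F in K]%classic.
Proof.
move=> _ [F KF <-]; split; first exact: cone_pointed.
exists [seq g p | p <- enum_fset F]; first exact: gen_free.
apply/seteqP; split=> D /=.
  case/(cone_extreme_ray _ KF) => p pF ->; exists (g p) => //.
  by rewrite /= map_f.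
by case=> v /mapP[p pF ->] <-; apply/(cone_extreme_ray _ KF); exists p.
Qed.

Lemma complex_complete : (forall x : E, exists F, K F /\
    exists2 c : T -> R, (forall p, 0 <= c p) & x = \sum_(p <- F) c p *: g p) ->
  complete_fan [set C F | F in K]%classic.
Proof.
move=> H; apply/seteqP; split=> // x _; have [F [KF [c c0 xc]]] := H x.
exists (C F); first by exists F.
apply/(mem_coneP _ KF); exists (fun p => if p \in F then c p else 0); split.
- by move=> p; case: ifP.
- by move=> p /negbTE ->.
- by rewrite xc; apply: eq_big_seq => p ->.
Qed.

End ConesOfComplex.

(** * The fan of the reduced nonkissing complex *)

Lemma reduced_NK_finite (lam : grid_shape) : finite_set (reduced_NK lam).
Proof.
have [P uP mP] := bpath_enum lam.
apply: (@finite_subfset _ (fpowerset [fset p in P]%fset)) => F FK /=.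
rewrite fpowersetE; apply/fsubsetP => p pF; rewrite inE /= mP.
by have [/(_ p pF)[]] := (reduced_NKP lam F).1 FK.
Qed.

Lemma reduced_NK_sub (lam : grid_shape) F G :
  reduced_NK lam F -> (G `<=` F)%fset -> reduced_NK lam G.
Proof.
move=> [H N] /fsubsetP GF; split=> [p /GF|p q /GF pF /GF]; [exact: H|exact: N].
Qed.

Theorem theorem5p2 (R : realType) (lam : grid_shape) :
  [/\ fan (NK_fan R lam), complete_fan (NK_fan R lam)
    & simplicial_fan (NK_fan R lam)].
Proof.
have uniq := @gvec_unique R lam.
split.
- by apply: complex_fan; [exact: reduced_NK_finite | exact: reduced_NK_sub | exact: uniq].
- by apply: complex_complete; [exact: uniq | exact: gvec_decomposition].
- by apply: complex_simplicial; [exact: reduced_NK_sub | exact: uniq].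
Qed.
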